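(* Let $\mathcal{K}$ be a complex separable Hilbert space, let $\{e_i\}_{i\in I}$ be an orthonormal basis of $\mathcal{K}$, let $Q\in\mathcal{A}_{\mathcal{I}}(\mathcal{K})$ be inner, and consider the model space $N=H^2_{\mathcal{K}}\ominus\widehat{Q}(H^2_{\mathcal{K}})$. Let $E_i=\widehat{Q}e_i$ for $i\in I$, and let $\mathfrak{B}_N^*=\{(S^* )^nS^*E_i\}_{i\in I,\,n\geqslant0}$ be the adjoint frame of $\mathfrak{B}_N=\{A_N^n(P_Ne_i)\}_{i\in I,\,n\geqslant0}$. Then the kernel of the synthesis operator $C:H^2_{\mathcal{K}}\to N$ of $\mathfrak{B}_N^*$, given by $$Cf=\sum_{i\in I,\,n\geqslant0}\langle f,S^ne_i\rangle\,(S^* )^nS^*E_i,$$ is $$\ker C=\widehat{\rho(Q)}H^2_{\mathcal{K}}.$$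
   Context: Let $\mathbb{T}$ be the unit circle with normalized Lebesgue measure and $H^2_{\mathcal{K}}\subseteq L^2(\mathbb{T},\mathcal{K})$ the Hardy space of square-integrable $\mathcal{K}$-valued functions whose Fourier coefficients of negative index vanish; $\mathcal{K}$ is identified with the constant functions. $S:H^2_{\mathcal{K}}\to H^2_{\mathcal{K}}$, $Sf(z)=zf(z)$, is the unilateral shift, $S^*f(z)=(f(z)-f(0))/z$. A model space is a closed $S^*$-invariant subspace $N\subseteq H^2_{\mathcal{K}}$, and $A_N:N\to N$, $A_Nf=P_NSf$, with $P_N$ the orthogonal projection onto $N$. For a measurable operator-valued function $Q:\mathbb{T}\to\mathcal{B}(\mathcal{K})$ with $\operatorname{ess\,sup}_{z\in\mathbb{T}}\|Q(z)\|<\infty$, define $(\widehat{Q}f)(z)=Q(z)f(z)$ on $L^2(\mathbb{T},\mathcal{K})$. $Q$ is analytic, written $Q\in\mathcal{A}(\mathcal{K})$, if $\widehat{Q}(H^2_{\mathcal{K}})\subseteq H^2_{\mathcal{K}}$; $Q\in\mathcal{A}(\mathcal{K})$ is inner, written $Q\in\mathcal{A}_{\mathcal{I}}(\mathcal{K})$, if $Q(z)$ is unitary on $\mathcal{K}$ for almost every $z$. The map $\rho:\mathcal{A}(\mathcal{K})\to\mathcal{A}(\mathcal{K})$ is $\rho(Q)(z)=Q(\overline{z})^*$ for a.e. $z\in\mathbb{T}$. For $Q$ inner and $N=H^2_{\mathcal{K}}\ominus\widehat{Q}(H^2_{\mathcal{K}})$, both systems $\mathfrak{B}_N$ and $\mathfrak{B}_N^*$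 are Parseval frames of $N$ (that is, $\sum_k|\langle x,x_k\rangle|^2=\|x\|^2$ for all $x\in N$, where $\{x_k\}_k$ is the system), so the series defining $C$ converges. *)

(* Defs.v *)
From HB Require Import structures.
From mathcomp Require Import all_boot all_order all_algebra sesquilinear.
From mathcomp Require Import finmap complex.
From mathcomp Require Import all_classical all_reals all_analysis.
From mathcomp Require Import measurable_realfun ess_sup_inf.
From mathcomp.analysis.showcase Require Import summability.

Set Implicit Arguments.
Unset Strict Implicit.
Unset Printing Implicit Defensive.

Import Order.TTheory GRing.Theory Num.Theory.
Import numFieldNormedType.Exports.

Local Open Scope classical_set_scope.
Local Open Scope ring_scope.
Local Open Scope complex_scope.

(* [dot x y] is linear in x and conjugate-linear in y. *)
HB.mixin Record CompleteNormedModule_isHilbert (R : realType) H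
    of CompleteNormedModule R[i] H := {
  dot : {dot H for @Num.conj R[i]} ;
  normr_dot : forall x : H, `|x| ^+ 2 = dot x x
}.

#[short(type="hilbertType")]
HB.structure Definition Hilbert (R : realType) :=
  { H of CompleteNormedModule R[i] H & CompleteNormedModule_isHilbert R H }.

Section HilbertSpace.
Context (R : realType) (K : hilbertType R).

Definition separable := exists2 D : set K, countable D & dense D.

Definition orthonormal_basis (I : choiceType) (e : I -> K) :=
  (forall i j, dot (e i) (e j) = (i == j)%:R) /\
  closure [set x | exists (F : {fset I}) (c : I -> R[i]),
                     x = \sum_(i <- F) c i *: e i] = setT.

(* The norm of [K] takes its values in R[i]. *)
Definition rnorm (x : K) : R := complex.Re `|x|.

Definition bounded_operator (A : K -> K) :=
  linear A /\ exists M : R, forall x, rnorm (A x) <= M * rnorm x.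

Definition opnorm (A : K -> K) : \bar R :=
  ereal_sup [set (rnorm (A x))%:E | x in [set x | rnorm x <= 1]].

(* [xget 0] selects the vector given by the Riesz representation theorem. *)
Definition adjoint (A : K -> K) : K -> K :=
  fun y => xget 0 [set w | forall x, dot (A x) y = dot x w].

Definition unitary (U : K -> K) :=
  [/\ linear U, (forall x y, dot (U x) (U y) = dot x y)
    & forall y, exists x, U x = y].

End HilbertSpace.

Section Circle.
Context (R : realType).

Definition circle := {z : R[i] | `|z| == 1}.

HB.instance Definition _ := SubChoice.on circle.

Fact circle1_subproof : `|1 : R[i]| == 1. Proof. by rewrite normr1. Qed.

HB.instance Definition _ :=
  isPointed.Build circle (exist _ 1 circle1_subproof).

(* The trace on the circle of the Borel sigma-algebra of R^2. *)
Definition circle_coord (z : circle) : measurableTypeR R * measurableTypeR R :=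
  (complex.Re (val z), complex.Im (val z)).

HB.instance Definition _ :=
  Measurable.copy circle (g_sigma_algebra_preimageType circle_coord).

Fact expi_subproof (t : R) : `|cos t +i* sin t| == 1 :> R[i].
Proof. by rewrite normc_def /= cos2Dsin2 sqrtr1. Qed.

Definition expi (t : measurableTypeR R) : circle :=
  exist _ (cos t +i* sin t) (expi_subproof t).

Fact measurable_expi : measurable_fun setT expi.
Proof.
move=> _ _ [B mB <-]; rewrite !setTI -comp_preimage.
rewrite -[X in measurable X]setTI.
pose T := measurableTypeR R.
apply: (@measurable_fun_pair _ _ _ T T T cos sin) => //;
  apply: continuous_measurable_fun.
  exact: continuous_cos.
exact: continuous_sin.
Qed.

HB.instance Definition _ := isMeasurableFun.Build _ _ _ _ expi measurable_expi.

Fact ltr0_2pi : 0 < pi *+ 2 :> R. Proof. by rewrite mulrn_wgt0 ?pi_gt0. Qed.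

Definition circle_measure := distribution (uniform_prob ltr0_2pi) expi.

Fact circle_conj_subproof (z : circle) : `|Num.conj (val z)| == 1.
Proof. by rewrite norm_conjC (valP z). Qed.

Definition circle_conj (z : circle) : circle :=
  exist _ (Num.conj (val z)) (circle_conj_subproof z).

Definition cmeasurable (f : circle -> R[i]) :=
  measurable_fun setT (fun z => complex.Re (f z)) /\
  measurable_fun setT (fun z => complex.Im (f z)).

Definition cintegral (f : circle -> R[i]) : R[i] :=
  Rintegral circle_measure setT (fun z => complex.Re (f z)) +i*
  Rintegral circle_measure setT (fun z => complex.Im (f z)).

End Circle.

(* Elements of L^2(T, K) are represented by square-integrable functions; no
   quotient is taken, and equality in L^2 is equality almost everywhere. *)
Section HardySpace.
Context (R : realType) (K : hilbertType R).
Local Notation T := (circle R).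
Local Notation m := (@circle_measure R).

(* Weak measurability, equivalent to Borel measurability when K is separable. *)
Definition vmeasurable (f : T -> K) :=
  forall x, cmeasurable (fun z => dot (f z) x).

Definition L2norm (f : T -> K) : \bar R := Lnorm m 2%:E (fun z => (rnorm (f z))%:E).

Definition L2 : set (T -> K) := [set f | vmeasurable f /\ (L2norm f < +oo)%E].

Definition L2dot (f g : T -> K) : R[i] := cintegral (fun z => dot (f z) (g z)).

(* The K-valued integral of z^-n f(z) is taken in the weak sense. *)
Definition is_fourier_coeff (f : T -> K) (n : int) (c : K) :=
  forall x, dot c x = cintegral (fun z => val z ^ (- n) * dot (f z) x).

Definition fourier_coeff (f : T -> K) (n : int) : K :=
  xget 0 [set c | is_fourier_coeff f n c].

Definition hardy : set (T -> K) :=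
  [set f | L2 f /\ forall n : int, n < 0 -> is_fourier_coeff f n 0].

Definition fwd_shift (f : T -> K) : T -> K := fun z => val z *: f z.

(* The value f(0) at the origin is the coefficient of index 0. *)
Definition bwd_shift (f : T -> K) : T -> K :=
  fun z => (val z)^-1 *: (f z - fourier_coeff f 0).

(* Unconditional convergence in L^2, along the finite sets of indices. *)
Definition L2_sum (J : choiceType) (x : J -> T -> K) (g : T -> K) :=
  (fun F : {fset J} => L2norm (fun z => \sum_(j <- F) x j z - g z)) @ totally
    --> 0%E.

Definition mul_op (Q : T -> K -> K) (f : T -> K) : T -> K := fun z => Q z (f z).

Definition opmeasurable (Q : T -> K -> K) :=
  forall x y, cmeasurable (fun z => dot (Q z x) y).

Definition analytic (Q : T -> K -> K) :=
  [/\ forall z, bounded_operator (Q z), opmeasurable Q,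
      (ess_sup m (fun z => opnorm (Q z)) < +oo)%E
    & forall f, hardy f -> hardy (mul_op Q f)].

Definition inner (Q : T -> K -> K) :=
  analytic Q /\ {ae m, forall z, unitary (Q z)}.

Definition rho (Q : T -> K -> K) : T -> K -> K :=
  fun z => adjoint (Q (circle_conj z)).

(* The image of H^2 in L^2, as a set of representatives: [f] has to be assumed
   measurable, as this is not invariant under equality almost everywhere. *)
Definition mul_op_hardy (Q : T -> K -> K) : set (T -> K) :=
  [set f | L2 f /\ exists2 g, hardy g & f = mul_op Q g %[ae m]].

Definition model_space (Q : T -> K -> K) : set (T -> K) :=
  [set f | hardy f /\ forall g, hardy g -> L2dot f (mul_op Q g) = 0].

Section Synthesis.
Context (I : choiceType) (e : I -> K) (Q : T -> K -> K).

Definition adjoint_frame (p : I * nat) : T -> K :=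
  iter p.2 bwd_shift (bwd_shift (mul_op Q (cst (e p.1)))).

(* The series converges, because the adjoint frame is a Parseval frame, and its
   sum is unique up to equality almost everywhere. *)
Definition synthesis (f : T -> K) : T -> K :=
  xget (cst 0) [set g | model_space Q g /\
    L2_sum (fun p z => L2dot f (iter p.2 fwd_shift (cst (e p.1))) *:
                         adjoint_frame p z) g].

Definition synthesis_kernel : set (T -> K) :=
  [set f | hardy f /\ synthesis f = cst 0 %[ae m]].

End Synthesis.
End HardySpace.

(* Main.v *)
Require Import Defs.
From HB Require Import structures.
From mathcomp Require Import all_boot all_order all_algebra sesquilinear.
From mathcomp Require Import finmap complex.
From mathcomp Require Import all_classical all_reals all_analysis.
From mathcomp Require Import measurable_realfun.
From mathcomp.analysis.showcase Require Import summability.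
From mathcomp Require Import ring lra.

(** Let [U] be the isometry of L^2 given by [(U f)(z) = z^-1 Q(z) f(conj z)], called
    [flip] below, and let [P] be the orthogonal projection of L^2 onto the Hardy
    space, which deletes the Fourier coefficients of negative index. The frame
    vector of index [(i, n)] is [P (z^(-n-1) Q e_i) = P (U (z^n e_i))]
    ([adjoint_frame_hardy]); summing against the coefficients of [f] gives
    [C f = P (U f)] ([synthesis_projection]). So [f] is in the kernel exactly when
    [U f] has no coefficient of index [n >= 0]. The function
    [h(z) = Q(conj z) f(z)] has as coefficient of index [n] the coefficient of
    index [-n-1] of [U f]; hence [f] is in the kernel exactly when [h] is in the
    Hardy space. Since [Q(conj z)] is unitary for almost every [z], the function
    [h] is the one with [f = rho(Q) h]. That [rho(Q)] maps the Hardy space to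
    itself is seen on coefficients: for [n > 0], the one of index [-n] of [rho(Q) h]
    along [e_i] is the inner product of [h(conj z)], whose indices are [<= 0], with
    [z^n Q e_i], whose indices are [>= n].

    The operator is defined as the sum of its series when there is one, so the
    unconditional convergence of the series in L^2 is part of the theorem. Its
    partial sums are [P (U f_F)], with [f_F] the partial Fourier sums of [f]; as [U]
    is isometric and [P] contracts, they converge because [f_F] converges to [f].
    This, and the projection [P] itself, rest on three facts about L^2: it is
    complete ([L2_complete], a Riesz-Fischer argument on almost everywhere
    convergent sequences), the functions [z^n e_i] are orthonormal
    ([fourier_basis_orthonormal]), and they are total ([Fcoef_ae0]). The consequences
    that are used ([restrict_coef], [expansion], [ip_eq0_disjoint],
    [sqnorm_le_restrict]) hold for every semi-inner product that is complete, and
    are proved at that generality because they serve for [K] and for L^2, whose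
    elements are functions and not classes.

    Totality reduces, coordinate by coordinate, to the scalar fact that an
    integrable function on the circle with vanishing Fourier coefficients vanishes
    almost everywhere ([null_moments_ae0]). The bounded functions that preserve
    this vanishing by multiplication form an algebra that is stable under bounded
    pointwise limits and contains [Re z] and [Im z]; it contains the signs of its
    elements, hence the indicators of all Borel sets. *)

Set Implicit Arguments.
Unset Strict Implicit.
Unset Printing Implicit Defensive.

Import Order.TTheory GRing.Theory Num.Theory.
Import numFieldNormedType.Exports.

Local Open Scope classical_set_scope.
Local Open Scope ring_scope.
Local Open Scope complex_scope.

(** * Complex numbers through real estimates *)

Section Nsq.
Context {R : realType}.
Implicit Types z w : R[i].

(** The squared modulus, as an element of [R]: estimates are made with real
    numbers only, so that no square root of a sum has to be taken. *)
Definition nsq z : R := complex.Re z ^+ 2 + complex.Im z ^+ 2.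

Lemma nsq_ge0 z : 0 <= nsq z.
Proof. by rewrite addr_ge0 ?sqr_ge0. Qed.

Lemma conjE z : Num.conj z = complex.Re z -i* complex.Im z.
Proof. by case: z. Qed.

Lemma mulJE z : z * Num.conj z = (nsq z)%:C.
Proof.
by case: z => a b; rewrite conjE /nsq; apply/eqP; rewrite eq_complex /=; apply/andP; split; apply/eqP; ring.
Qed.

Lemma nsqM z w : nsq (z * w) = nsq z * nsq w.
Proof. case: z => a b; case: w => c d; rewrite /nsq /=; ring. Qed.

Lemma nsqN z : nsq (- z) = nsq z.
Proof. case: z => a b; rewrite /nsq /=; ring. Qed.

Lemma nsq0 : nsq 0 = 0. Proof. by rewrite /nsq /=; ring. Qed.

Lemma nsq_eq0 z : nsq z <= 0 -> z = 0.
Proof.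
case: z => a b; rewrite /nsq /= => h; apply/eqP; rewrite eq_complex /=.
have ha := sqr_ge0 a; have hb := sqr_ge0 b.
by rewrite -(sqrf_eq0 a) -(sqrf_eq0 b); apply/andP; split; apply/eqP; lra.
Qed.

Lemma nsqD_le z w : nsq (z + w) <= 2 * nsq z + 2 * nsq w.
Proof.
case: z => a b; case: w => c d; rewrite /nsq /=.
have := sqr_ge0 (a - c); have := sqr_ge0 (b - d); nra.
Qed.

Lemma le0_of_geometric (d C : R) : (forall k, d <= C * 4^-1 ^+ k) -> d <= 0.
Proof.
move=> h.
have cv : (fun k => C * 4^-1 ^+ k) @ \oo --> (0 : R).
  rewrite -[X in _ --> X](mulr0 C).
  apply: cvgM; first exact: cvg_cst.
  by apply: cvg_expr; rewrite ger0_norm; lra.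
rewrite -(cvg_lim _ cv)//; apply: limr_ge; first by apply/cvg_ex; exists 0.
by apply: nearW => k; exact: h.
Qed.

End Nsq.

(** * Orthonormal families in a complete semi-inner product space *)

Section PreHilbert.
Context {R : realType} (V : lmodType R[i]) (ip : V -> V -> R[i]).
Hypothesis ip_linearl : forall a x y z, ip (a *: x + y) z = a * ip x z + ip y z.
Hypothesis ipC : forall x y, ip y x = Num.conj (ip x y).
Hypothesis ip_ge0 : forall x, 0 <= ip x x.

(** The squared seminorm. Definiteness is not assumed, so that functions that
    agree almost everywhere need not be identified. *)
Definition sqnorm (x : V) : R := complex.Re (ip x x).

Lemma ipDl x y z : ip (x + y) z = ip x z + ip y z.
Proof. by have := ip_linearl 1 x y z; rewrite scale1r mul1r. Qed.
Lemma ip0l z : ip 0 z = 0.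
Proof. by apply: (addrI (ip 0 z)); rewrite -ipDl !addr0. Qed.
Lemma ipZl a x z : ip (a *: x) z = a * ip x z.
Proof. by have := ip_linearl a x 0 z; rewrite !addr0 ip0l addr0. Qed.
Lemma ipNl x z : ip (- x) z = - ip x z.
Proof. by rewrite -scaleN1r ipZl mulN1r. Qed.
Lemma ipBl x y z : ip (x - y) z = ip x z - ip y z.
Proof. by rewrite ipDl ipNl. Qed.
Lemma ipDr x y z : ip z (x + y) = ip z x + ip z y.
Proof. by rewrite [LHS]ipC ipDl raddfD /= -!ipC. Qed.
Lemma ip0r z : ip z 0 = 0.
Proof. by rewrite ipC ip0l conjC0. Qed.
Lemma ipZr a x z : ip z (a *: x) = Num.conj a * ip z x.
Proof. by rewrite [LHS]ipC ipZl rmorphM /= -!ipC. Qed.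
Lemma ipNr x z : ip z (- x) = - ip z x.
Proof. by rewrite [LHS]ipC ipNl raddfN /= -!ipC. Qed.
Lemma ip_suml (J : Type) (s : seq J) (f : J -> V) z :
  ip (\sum_(j <- s) f j) z = \sum_(j <- s) ip (f j) z.
Proof.
elim: s => [|j s ih]; first by rewrite !big_nil ip0l.
by rewrite !big_cons ipDl ih.
Qed.
Lemma ip_sumr (J : Type) (s : seq J) (f : J -> V) z :
  ip z (\sum_(j <- s) f j) = \sum_(j <- s) ip z (f j).
Proof.
elim: s => [|j s ih]; first by rewrite !big_nil ip0r.
by rewrite !big_cons ipDr ih.
Qed.

Lemma ipxx x : ip x x = (sqnorm x)%:C.
Proof.
have := ip_ge0 x; rewrite lecE /= => /andP[/eqP i0 _].
by rewrite /sqnorm; case: (ip x x) i0 => a b /= ->.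
Qed.

Lemma sqnorm_ge0 x : 0 <= sqnorm x.
Proof. by have := ip_ge0 x; rewrite lecE => /andP[]. Qed.

Lemma sqnormD x y : sqnorm (x + y) = sqnorm x + sqnorm y + 2 * complex.Re (ip x y).
Proof.
rewrite {1}/sqnorm ipDl !ipDr !ipxx (ipC x y) conjE.
by case: (ip x y) => a b /=; ring.
Qed.

Lemma sqnormZ a x : sqnorm (a *: x) = nsq a * sqnorm x.
Proof.
by rewrite {1}/sqnorm ipZl ipZr mulrA mulJE ipxx /= mul0r subr0.
Qed.

Lemma sqnormN x : sqnorm (- x) = sqnorm x.
Proof. by rewrite /sqnorm ipNl ipNr opprK. Qed.

Lemma sqnormBC x y : sqnorm (x - y) = sqnorm (y - x).
Proof. by rewrite -sqnormN opprB. Qed.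

Lemma sqnormB x y : sqnorm (x - y) = sqnorm x + sqnorm y - 2 * complex.Re (ip x y).
Proof. by rewrite sqnormD sqnormN ipNr; case: (ip x y) => a b /=; ring. Qed.

Lemma sqnormD_le x y : sqnorm (x + y) <= 2 * sqnorm x + 2 * sqnorm y.
Proof. by have := sqnorm_ge0 (x - y); rewrite sqnormB (sqnormD x y); lra. Qed.

(** The proof minimizes [sqnorm (x - c t y)] over real [c], where [t = ip x
    y]; when [sqnorm y = 0] this is affine in [c] and nonnegative, which
    forces [t = 0]. *)
Lemma cauchy_schwarz x y : nsq (ip x y) <= sqnorm x * sqnorm y.
Proof.
set t := ip x y.
have key (c : R) : 0 <= sqnorm x - 2 * c * nsq t + c ^+ 2 * nsq t * sqnorm y.
  have := sqnorm_ge0 (x - (c%:C * t) *: y).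
  rewrite sqnormB sqnormZ ipZr -/t rmorphM /= -mulrA (mulrC (Num.conj t)) mulJE.
  rewrite nsqM conjE /= /nsq /=.
  set u := sqnorm x; set v := sqnorm y => h; apply: le_trans h _.
  by rewrite le_eqVlt; apply/orP; left; apply/eqP; ring.
have x0 := sqnorm_ge0 x; have y0 := sqnorm_ge0 y; have t0 := nsq_ge0 t.
have [yz|yn] := eqVneq (sqnorm y) 0.
  rewrite yz mulr0; rewrite leNgt; apply/negP => tp.
  (* With [sqnorm y = 0], any [c] above [sqnorm x / (2 nsq t)] contradicts [key]. *)
  have := key ((sqnorm x + 1) / (2 * nsq t)); rewrite yz mulr0 addr0.
  suff -> : 2 * ((sqnorm x + 1) / (2 * nsq t)) * nsq t = sqnorm x + 1 by lra.
  by field; rewrite gt_eqF.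
have yp : 0 < sqnorm y by rewrite lt_neqAle eq_sym yn.
have := key ((sqnorm y)^-1).
suff -> : sqnorm x - 2 * (sqnorm y)^-1 * nsq t + (sqnorm y)^-1 ^+ 2 * nsq t * sqnorm y =
  (sqnorm x * sqnorm y - nsq t) / sqnorm y.
  by rewrite pmulr_lge0 ?invr_gt0// subr_ge0.
by field.
Qed.

Lemma ip_null x y : sqnorm x = 0 -> ip x y = 0.
Proof. by move=> x0; apply: nsq_eq0; rewrite (le_trans (cauchy_schwarz x y))// x0 mul0r. Qed.

(** Null vectors are orthogonal to everything. *)
Lemma sqnormB_null x y : sqnorm y = 0 -> sqnorm (x - y) = sqnorm x.
Proof.
by move=> y0; rewrite sqnormB y0 ipC ip_null// conjC0 /=; ring.
Qed.

Context {P : choiceType} (b : P -> V).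
Hypothesis basisON : forall p q, ip (b p) (b q) = (p == q)%:R.

Definition lincomb (F : {fset P}) (c : P -> R[i]) : V := \sum_(p <- F) c p *: b p.

(** The squared norm of [lincomb F c]; bounding it over all [F] says that [c]
    is square-summable. *)
Definition energy (F : {fset P}) (c : P -> R[i]) : R := \sum_(p <- F) nsq (c p).

Lemma ip_lincomb F c q : ip (lincomb F c) (b q) = if q \in F then c q else 0.
Proof.
rewrite /lincomb ip_suml; case: ifPn => qF.
  rewrite (bigD1_seq q) ?fset_uniq//= ipZl basisON eqxx mulr1 big1 ?addr0// => p pq.
  by rewrite ipZl basisON (negbTE pq) mulr0.
rewrite big_seq big1// => p pF; rewrite ipZl basisON.
by case: eqVneq => [pq|]; rewrite ?mulr0//; rewrite -pq pF in qF.
Qed.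

Lemma ip_lincombr F c x : (forall p, p \in F -> ip x (b p) = c p) ->
  ip x (lincomb F c) = (energy F c)%:C.
Proof.
move=> h; rewrite /lincomb /energy ip_sumr raddf_sum /= big_seq [RHS]big_seq.
by apply: eq_bigr => p pF; rewrite ipZr h// mulrC mulJE.
Qed.

Lemma sqnorm_lincomb F c : sqnorm (lincomb F c) = energy F c.
Proof. by rewrite /sqnorm (@ip_lincombr F c) //= => p pF; rewrite ip_lincomb pF. Qed.

Lemma energy_le F G c : (F `<=` G)%fset -> energy F c <= energy G c.
Proof.
move=> FG; rewrite /energy [leRHS](big_fsetID _ (mem F))/=.
rewrite (_ : [fset x in G | x \in F]%fset = F).
  by rewrite lerDl sumr_ge0// => p _; exact: nsq_ge0.
apply/fsetP => p; rewrite !inE andbC; case: (boolP (p \in F)) => //= pF.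
exact: (fsubsetP FG).
Qed.

Lemma sqnorm_lincombB F G c : (F `<=` G)%fset ->
  sqnorm (lincomb G c - lincomb F c) = energy G c - energy F c.
Proof.
move=> FG; rewrite sqnormB !sqnorm_lincomb ip_lincombr /=; first by ring.
by move=> p pF; rewrite ip_lincomb (fsubsetP FG).
Qed.

Definition coef x p := ip x (b p).

Lemma sqnorm_sub_lincomb F x : sqnorm (x - lincomb F (coef x)) = sqnorm x - energy F (coef x).
Proof. by rewrite sqnormB sqnorm_lincomb (@ip_lincombr F (coef x))//=; ring. Qed.

Lemma bessel F x : energy F (coef x) <= sqnorm x.
Proof. by rewrite -subr_ge0 -sqnorm_sub_lincomb sqnorm_ge0. Qed.

Hypothesis complete : forall u : nat -> V,
  (forall k, sqnorm (u k.+1 - u k) <= 16^-1 ^+ k) ->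
  exists v, exists C : R, forall k, sqnorm (u k - v) <= C * 4^-1 ^+ k.

(** Finite sets [F k] whose energy is within [16^-k] of the supremum give
    partial sums that are Cauchy at a fixed rate, without any enumeration of
    the index type; an index that is never reached has a zero coefficient, as
    adding it to [F k] raises the energy by at most [16^-k]. *)
Lemma riesz_fischer (c : P -> R[i]) (M : R) : (forall F, energy F c <= M) ->
  exists2 y, (forall p, coef y p = c p) &
    forall eps, 0 < eps -> exists F, sqnorm (y - lincomb F c) <= eps.
Proof.
move=> cM.
pose A := [set energy F c | F in [set: {fset P}]].
have hA : has_sup A.
  split; first by exists (energy fset0 c); exists fset0.
  by exists M => _ [F _ <-]; exact: cM.
have /boolp.choice [G HG] : forall k, exists F, sup A - 16^-1 ^+ k < energy F c.
  move=> k.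
  have e0 : 0 < (16^-1 : R) ^+ k by rewrite exprn_gt0//; lra.
  by have [_ [F _ <-] hF] := sup_adherent e0 hA; exists F.
pose F := fix F k := if k is k'.+1 then (F k' `|` G k)%fset else G 0%N.
(* The union makes the sequence increasing; [G k] keeps its energy near the supremum. *)
have FS k : (F k `<=` F k.+1)%fset by rewrite /= fsubsetUl.
have GF k : (G k `<=` F k)%fset by case: k => [|k] /=; rewrite ?fsubset_refl ?fsubsetUr.
have supF H : energy H c <= sup A by apply: (sup_upper_bound hA); exists H.
have lowF k : sup A - 16^-1 ^+ k < energy (F k) c.
  exact: lt_le_trans (HG k) (energy_le _ (GF k)).
have [v [C vC]] : exists v, exists C : R, forall k, sqnorm (lincomb (F k) c - v) <= C * 4^-1 ^+ k.
  apply: (@complete (fun k => lincomb (F k) c)) => k; rewrite (sqnorm_lincombB _ (FS k)).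
  by have := supF (F k.+1); have := lowF k; lra.
exists v.
  move=> p; apply/eqP; rewrite -subr_eq0; apply/eqP/nsq_eq0.
  (* [2 C] comes from the distance of [v] to the partial sum, [2] from the energy missed. *)
  apply: (@le0_of_geometric R _ (2 * C + 2)) => k.
  rewrite (_ : coef v p - c p = coef (v - lincomb (F k) c) p + (ip (lincomb (F k) c) (b p) - c p)); last first.
    by rewrite /coef ipBl; ring.
  apply: le_trans (nsqD_le _ _) _; rewrite (mulrDl (2 * C)); apply: lerD.
    rewrite -mulrA ler_pM2l//.
    apply: le_trans (cauchy_schwarz _ _) _; rewrite {2}/sqnorm basisON eqxx /= mulr1.
    by rewrite sqnormBC.
  rewrite ler_pM2l// ip_lincomb; case: ifPn => pF.
    by rewrite subrr nsq0 exprn_ge0//; lra.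
  rewrite sub0r nsqN; apply: (@le_trans _ _ (16^-1 ^+ k)); last first.
    by apply: lerXn2r; rewrite ?nnegrE; lra.
  have := supF (p |` F k)%fset; have := lowF k.
  rewrite /energy big_fsetU1//=; lra.
move=> eps e0; apply: contrapT => /forallNP hn.
suff : eps <= 0 by lra.
apply: (@le0_of_geometric R _ C) => k; apply: le_trans (vC k).
by rewrite sqnormBC ltW// ltNge; apply/negP; exact: hn.
Qed.

(** The projection onto the closed span of the [b p] with [A p]. *)
Lemma restrict_coef (A : pred P) x :
  exists y, forall p, coef y p = if A p then coef x p else 0.
Proof.
have [|y hy _] := @riesz_fischer (fun p => if A p then coef x p else 0) (sqnorm x).
  move=> F; apply: le_trans (bessel F x); apply: ler_sum => p _.
  by case: ifP => // _; rewrite nsq0 nsq_ge0.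
by exists y.
Qed.

Hypothesis total : forall x, (forall p, coef x p = 0) -> sqnorm x = 0.

(** Two vectors with the same coefficients differ by a null vector, so [x] is
    the sum given by [riesz_fischer]; Bessel's identity turns one good finite
    set into convergence along the finite sets that contain it. *)
Lemma expansion x eps : 0 < eps -> exists F0 : {fset P},
  forall F, (F0 `<=` F)%fset -> sqnorm (x - lincomb F (coef x)) <= eps.
Proof.
move=> e0.
have [y hy /(_ _ e0)[F hF]] := @riesz_fischer (coef x) _ (bessel^~ x).
exists F => G FG; rewrite sqnorm_sub_lincomb.
have xy : sqnorm (x - y) = 0.
  by apply: total => p; rewrite /coef ipBl [ip y _]hy subrr.
have : sqnorm (x - lincomb F (coef x)) <= eps.
  rewrite (_ : x - _ = (y - lincomb F (coef x)) - (y - x)); last first.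
    by rewrite opprB [RHS]addrC addrA subrK.
  by rewrite sqnormB_null// sqnormBC.
by rewrite sqnorm_sub_lincomb; have := energy_le (coef x) FG; lra.
Qed.

(** Every finite partial sum of [x] is orthogonal to [y]. *)
Lemma ip_eq0_disjoint x y :
  (forall p, coef x p = 0 \/ coef y p = 0) -> ip x y = 0.
Proof.
move=> h; apply: nsq_eq0; rewrite leNgt; apply/negP => t0.
have y0 := sqnorm_ge0 y.
(* Small enough for [cauchy_schwarz] to give [nsq (ip x y) < nsq (ip x y)]. *)
have e0 : 0 < nsq (ip x y) / (sqnorm y + 1) / 2 by rewrite !divr_gt0//; lra.
have [F /(_ F (fsubset_refl _)) hF] := expansion x e0.
have xF : ip (lincomb F (coef x)) y = 0.
  rewrite /lincomb ip_suml big1// => p _; rewrite ipZl ipC.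
  by case: (h p) => [->|yp]; [rewrite mul0r | rewrite [ip _ _]yp conjC0 mulr0].
have := cauchy_schwarz (x - lincomb F (coef x)) y.
rewrite ipBl xF subr0 => cs.
have : nsq (ip x y) <= nsq (ip x y) / (sqnorm y + 1) / 2 * sqnorm y.
  by apply: le_trans cs _; rewrite ler_wpM2r.
suff : nsq (ip x y) / (sqnorm y + 1) / 2 * sqnorm y < nsq (ip x y) by lra.
rewrite -mulrA -mulrA gtr_pMr// mulrCA mulrC -mulrA ltr_pdivrMl; nra.
Qed.

(** Deleting coefficients does not increase the norm: [x] is orthogonal to [y
    - x]. *)
Lemma sqnorm_le_restrict x y :
  (forall p, coef x p = 0 \/ coef x p = coef y p) -> sqnorm x <= sqnorm y.
Proof.
move=> h; rewrite -[y](subrK x) addrC sqnormD.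
rewrite ip_eq0_disjoint ?mulr0/= ?addr0 ?lerDl ?sqnorm_ge0//.
move=> p; case: (h p) => hp; [by left|right].
by rewrite /coef ipBl -[ip x _]/(coef x p) hp /coef subrr.
Qed.

End PreHilbert.

(** * Hilbert spaces *)

Section HilbertFacts.
Context {R : realType} (K : hilbertType R).

Lemma dot_linearl a (x y z : K) : dot (a *: x + y) z = a * dot x z + dot y z.
Proof. exact: linearPl. Qed.
Lemma dotC (x y : K) : dot y x = Num.conj (dot x y).
Proof. by rewrite hermC expr0 mul1r. Qed.
Lemma dot_ge0 (x : K) : 0 <= dot x x.
Proof. by rewrite -normr_dot exprn_ge0. Qed.

Definition ksq (x : K) : R := complex.Re (dot x x).

Lemma normE (x : K) : `|x| = (rnorm x)%:C.
Proof. by rewrite /rnorm RRe_real// normr_real. Qed.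

Lemma rnorm_ge0 (x : K) : 0 <= rnorm x.
Proof. by rewrite -ler0c -normE. Qed.

Lemma rnorm_sq (x : K) : rnorm x ^+ 2 = ksq x.
Proof. by rewrite /ksq -normr_dot normE -rmorphXn. Qed.

Lemma ksq_eq0 (x : K) : ksq x <= 0 -> x = 0.
Proof.
rewrite -rnorm_sq => h; apply/normr0_eq0; rewrite normE.
suff -> : rnorm x = 0 by [].
by apply/eqP; rewrite -sqrf_eq0 eq_le h sqr_ge0.
Qed.

(** Completeness of [K] with an explicit rate; the factor [4] is the square of
    the sum of the powers of [1/2]. The bound [h] is kept because in
    [L2_complete] it is an integrable function of the point. *)
Lemma complete_geometric (u : nat -> K) (h : R) :
  (forall k, 4 ^+ k * ksq (u k.+1 - u k) <= h) ->
  exists v, forall k, ksq (u k - v) <= 4 * h * 4^-1 ^+ k.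
Proof.
move=> uh.
have h0 : 0 <= h.
  by apply: le_trans (uh 0%N); rewrite expr0 mul1r -rnorm_sq sqr_ge0.
pose s := Num.sqrt h.
have s0 : 0 <= s by exact: sqrtr_ge0.
have norm_le (x : K) (c : R) : 0 <= c -> ksq x <= c ^+ 2 -> rnorm x <= c.
  by move=> c0; rewrite -rnorm_sq ler_pXn2r// nnegrE ?rnorm_ge0.
have triangle (x y : K) : rnorm (x + y) <= rnorm x + rnorm y.
  by rewrite -lecR -(normE (x + y)) rmorphD /= -(normE x) -(normE y); exact: ler_normD.
have step k : rnorm (u k.+1 - u k) <= s * 2^-1 ^+ k.
  apply: norm_le; first by rewrite mulr_ge0// exprn_ge0.
  rewrite exprMn sqr_sqrtr// -exprM mulnC exprM expr2 -invfM -natrM.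
  by rewrite exprVn ler_pdivlMr ?exprn_gt0// mulrC.
have far k j : rnorm (u (k + j)%N - u k) <= 2 * s * 2^-1 ^+ k * (1 - 2^-1 ^+ j).
  elim: j => [|j ih].
    rewrite addn0 subrr expr0 subrr mulr0 /rnorm normr0 //.
  rewrite addnS (_ : _ - u k = (u (k + j).+1 - u (k + j)%N) + (u (k + j)%N - u k)); last first.
    by rewrite addrA subrK.
  apply: le_trans (triangle _ _) _; apply: le_trans (lerD (step _) ih) _.
  rewrite exprD exprS le_eqVlt; apply/orP; left; apply/eqP.
  by field.
have far' k n : (k <= n)%N -> rnorm (u n - u k) <= 2 * s * 2^-1 ^+ k.
  move=> kn; rewrite -(subnKC kn); apply: le_trans (far _ _) _.
  by rewrite ler_piMr ?mulr_ge0 ?exprn_ge0// gerBl exprn_ge0.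
have small (e : R) : 0 < e -> exists k, 2 * s * 2^-1 ^+ k < e.
  move=> e0.
  have cv : (fun k => 2 * s * 2^-1 ^+ k) @ \oo --> (0 : R).
    rewrite -[X in _ --> X](mulr0 (2 * s)); apply: cvgM; first exact: cvg_cst.
    by apply: cvg_expr; rewrite ger0_norm; lra.
  have /cvgrPdist_lt/(_ _ e0)[k _ /(_ k (leqnn k))] := cv.
  rewrite sub0r normrN ger0_norm ?mulr_ge0 ?exprn_ge0// => hk.
  by exists k.
have uc : cauchy (u @ \oo).
  apply/cauchyP => e e0.
  have eE : e = (complex.Re e)%:C by rewrite RRe_real// gtr0_real.
  have [|k hk] := small (complex.Re e); first by rewrite -ltcR -eE.
  exists (u k); exists k => // n /= kn.
  rewrite -ball_normE /ball_ /= normE eE ltcR /rnorm distrC.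
  exact: le_lt_trans (far' _ _ kn) hk.
have /cvg_ex[v uv] : cvg (u @ \oo) by exact: cauchy_cvg.
exists v => k.
suff : rnorm (u k - v) <= 2 * s * 2^-1 ^+ k.
  rewrite -rnorm_sq => hk.
  have -> : 4 * h * 4^-1 ^+ k = (2 * s * 2^-1 ^+ k) ^+ 2.
    rewrite (_ : 4^-1 = 2^-1 ^+ 2 :> R); last by field.
    rewrite -exprM mulnC exprM !exprMn sqr_sqrtr//.
    by ring.
  by rewrite ler_pXn2r// nnegrE ?rnorm_ge0// !mulr_ge0// exprn_ge0.
apply/ler_addgt0Pr => e e0.
have /cvgrPdist_lt/(_ e%:C) := uv; rewrite ltcR => /(_ e0)[N _ hN].
have := hN (maxn N k) (leq_maxl _ _); rewrite normE ltcR => h1.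
have h2 := far' _ _ (leq_maxr N k).
rewrite (_ : u k - v = - (u (maxn N k) - u k) + - (v - u (maxn N k))); last first.
  by rewrite !opprB addrA subrK.
apply: le_trans (triangle _ _) _.
by rewrite /rnorm !normrN -/(rnorm _) -/(rnorm _) lerD// ltW.
Qed.

End HilbertFacts.

Section DotAlgebra.
Context {R : realType} (K : hilbertType R).
Implicit Types x y z : K.

Lemma ksq_ge0 x : 0 <= ksq x.
Proof. exact: (sqnorm_ge0 (@dot_ge0 R K)). Qed.
Lemma ksqB x y : ksq (x - y) = ksq x + ksq y - 2 * complex.Re (dot x y).
Proof. exact: (sqnormB (@dot_linearl R K) (@dotC R K) (@dot_ge0 R K)). Qed.
Lemma ksqD x y : ksq (x + y) = ksq x + ksq y + 2 * complex.Re (dot x y).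
Proof. exact: (sqnormD (@dot_linearl R K) (@dotC R K) (@dot_ge0 R K)). Qed.
Lemma ksqBC x y : ksq (x - y) = ksq (y - x).
Proof. exact: (sqnormBC (@dot_linearl R K) (@dotC R K)). Qed.
Lemma ksqD_le x y : ksq (x + y) <= 2 * ksq x + 2 * ksq y.
Proof. exact: (sqnormD_le (@dot_linearl R K) (@dotC R K) (@dot_ge0 R K)). Qed.
Lemma ksqZ a x : ksq (a *: x) = nsq a * ksq x.
Proof. exact: (sqnormZ (@dot_linearl R K) (@dotC R K) (@dot_ge0 R K)). Qed.
Lemma dotBl x y z : dot (x - y) z = dot x z - dot y z.
Proof. exact: linearBl. Qed.
Lemma dotZl a x z : dot (a *: x) z = a * dot x z.
Proof. exact: linearZl_LR. Qed.
Lemma dot0l z : dot 0 z = 0 :> R[i].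
Proof. exact: linear0l. Qed.
Lemma dotBr x y z : dot z (x - y) = dot z x - dot z y.
Proof. exact: linearBr. Qed.
Lemma dotZr a x z : dot z (a *: x) = Num.conj a * dot z x.
Proof. exact: linearZr_LR. Qed.
Lemma dot_cauchy_schwarz x y : nsq (dot x y) <= ksq x * ksq y.
Proof. exact: (cauchy_schwarz (@dot_linearl R K) (@dotC R K) (@dot_ge0 R K)). Qed.
Lemma dotxx x : dot x x = (ksq x)%:C.
Proof. exact: (ipxx (@dot_ge0 R K)). Qed.
Lemma dot_suml (J : Type) (s : seq J) (f : J -> K) z :
  dot (\sum_(j <- s) f j) z = \sum_(j <- s) dot (f j) z.
Proof. exact: (ip_suml (@dot_linearl R K)). Qed.
Lemma dot_sumr (J : Type) (s : seq J) (f : J -> K) z :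
  dot z (\sum_(j <- s) f j) = \sum_(j <- s) dot z (f j).
Proof. exact: (ip_sumr (@dot_linearl R K) (@dotC R K)). Qed.

End DotAlgebra.

(** * Orthonormal bases of a separable Hilbert space *)

Section OrthonormalBasis.
Context {R : realType} (K : hilbertType R) (I : choiceType) (e : I -> K).
Hypothesis he : orthonormal_basis e.

Lemma basis_orthonormal i j : dot (e i) (e j) = (i == j)%:R.
Proof. exact: he.1. Qed.

Lemma ball_ksq (x y : K) (eps : R) : 0 < eps ->
  ball x (eps%:C) y -> ksq (x - y) <= eps ^+ 2.
Proof.
move=> e0; rewrite -ball_normE /ball_ /= normE ltcR => h.
by rewrite -rnorm_sq ler_pXn2r ?nnegrE ?rnorm_ge0// ltW.
Qed.

Lemma span_dense (x : K) (eps : R) : 0 < eps ->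
  exists (F : {fset I}) (c : I -> R[i]), ksq (x - \sum_(i <- F) c i *: e i) <= eps ^+ 2.
Proof.
move=> e0.
have : closure [set x | exists (F : {fset I}) (c : I -> R[i]), x = \sum_(i <- F) c i *: e i] x.
  by rewrite he.2.
move=> /(_ (ball x eps%:C)) []; first by apply: nbhsx_ballx; rewrite ltcR.
by move=> y [[F [c ->]] /(ball_ksq e0) h]; exists F, c.
Qed.

Lemma basis_total (x : K) : (forall i, dot x (e i) = 0) -> ksq x = 0.
Proof.
move=> h; apply/eqP; rewrite eq_le ksq_ge0 andbT.
rewrite leNgt; apply/negP => x0.
pose d := Num.sqrt (ksq x / 2).
have d0 : 0 < d by rewrite sqrtr_gt0 divr_gt0.
have [F [c]] := span_dense x d0.
rewrite sqr_sqrtr; last by rewrite divr_ge0// ltW.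
rewrite ksqB (_ : dot x (\sum_(i <- F) c i *: e i) = 0).
  by have := ksq_ge0 (\sum_(i <- F) c i *: e i); rewrite /=; lra.
rewrite dot_sumr big1// => i _.
by rewrite dotZr h mulr0.
Qed.

Lemma basis_ext (x y : K) : (forall i, dot x (e i) = dot y (e i)) -> x = y.
Proof.
move=> h; apply/eqP; rewrite -subr_eq0; apply/eqP/ksq_eq0.
by rewrite basis_total// => i; rewrite dotBl h subrr.
Qed.

(** The completeness property that [riesz_fischer] asks for; the rate [16^-k]
    leaves room for a factor [4^k]. *)
Lemma hilbert_complete (u : nat -> K) :
  (forall k, ksq (u k.+1 - u k) <= 16^-1 ^+ k) ->
  exists v, exists C : R, forall k, ksq (u k - v) <= C * 4^-1 ^+ k.
Proof.
move=> h; have [|v hv] := @complete_geometric R K u 1; last by exists v, (4 * 1).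
move=> k; apply: (@le_trans _ _ (4 ^+ k * 16^-1 ^+ k)).
  by rewrite ler_pM2l ?exprn_gt0.
by rewrite -exprMn exprn_ile1//; lra.
Qed.

Lemma basis_expansion (x : K) (eps : R) : 0 < eps -> exists F0 : {fset I},
  forall F, (F0 `<=` F)%fset -> ksq (x - \sum_(i <- F) dot x (e i) *: e i) <= eps.
Proof.
exact: (expansion (@dot_linearl R K) (@dotC R K) (@dot_ge0 R K) basis_orthonormal
  hilbert_complete basis_total).
Qed.

Hypothesis hK : separable K.

(** Distinct basis vectors are at distance [sqrt 2], so the points of a dense
    set that are [1/2]-close to them are distinct. *)
Lemma countable_basis : countable [set: I].
Proof.
have [D cD dD] := hK.
have /boolp.choice[d hd] : forall i, exists y, D y /\ ksq (e i - y) <= 2^-1 ^+ 2.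
  move=> i; have h2 : 0 < 2^-1 :> R by lra.
  have [|y [hy Dy]] := dD (interior (ball (e i) (2^-1 : R)%:C)) _ (@open_interior _ _).
    exists (e i); apply: nbhs_singleton; apply: nbhs_interior.
    by apply: nbhsx_ballx; rewrite ltcR.
  by exists y; split => //; apply: ball_ksq => //; exact: interior_subset.
have dinj : injective d.
  move=> i j dij; apply: contrapT => /eqP ij.
  have := ksqD_le (e i - d i) (d j - e j).
  rewrite dij addrA subrK (ksqBC (d j)).
  rewrite (ksqB (e i) (e j)) /ksq !basis_orthonormal (negbTE ij) !eqxx /=.
  have := (hd i).2; have := (hd j).2; rewrite dij /ksq; lra.
have : countable (d @` [set: I]).
  apply: (@sub_countable _ _ _ D) => //; apply: subset_card_le => _ [i _ <-].
  exact: (hd i).1.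
by rewrite (eq_countable (inj_card_eq _))// => i j _ _; exact: dinj.
Qed.

(** A sequence of finite sets that is cofinal among all finite sets, so that
    expansions in the basis are limits of sequences, which preserve
    measurability. *)
Lemma exhausting_fsets : exists F : nat -> {fset I}, forall F0 : {fset I},
  exists N, forall k, (N <= k)%N -> (F0 `<=` F k)%fset.
Proof.
have /countable_injP[f finj] := countable_basis.
have injf : injective f by move=> i j; apply: finj; rewrite inE.
pose F k := fset_set [set i | (f i < k)%N].
have finF k : finite_set [set i | (f i < k)%N].
  apply: (@finite_preimage _ _ `I_k f); last exact: finite_II.
  by move=> i j _ _; exact: injf.
exists F => F0; exists (\max_(i <- F0) f i).+1 => k hk.
apply/fsubsetP => i iF; rewrite /F in_fset_set// inE /=.
apply: leq_trans hk; rewrite ltnS.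
by rewrite (big_rem i)//= leq_maxl.
Qed.

End OrthonormalBasis.

(** * Integration of complex functions on the circle *)

Section ComplexIntegral.
Context {R : realType}.
Local Notation T := (circle R).
Local Notation m := (@circle_measure R).
Local Notation C := R[i].
Implicit Types (w v : T -> C) (g : T -> R).

Definition rintegrable g := m.-integrable setT (EFin \o g).

Lemma rintegrable_measurable g : rintegrable g -> measurable_fun setT g.
Proof. by move=> /measurable_int /measurable_EFinP. Qed.

Lemma rintegrable_le g h : measurable_fun setT g -> rintegrable h ->
  (forall z, `|g z| <= h z) -> rintegrable g.
Proof.
move=> mg ih gh; apply: (le_integrable measurableT _ _ ih).
  exact/measurable_EFinP.
by move=> z _ /=; rewrite lee_fin (le_trans (gh z))// ler_norm.
Qed.

Lemma rintegrableD g h : rintegrable g -> rintegrable h ->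
  rintegrable (fun z => g z + h z).
Proof. by move=> ig ih; have := integrableD measurableT ig ih. Qed.

Lemma rintegrableZ a g : rintegrable g -> rintegrable (fun z => a * g z).
Proof. by move=> ig; have := integrableZl measurableT a ig. Qed.

Lemma rintegrable_norm g : rintegrable g -> rintegrable (fun z => `|g z|).
Proof. by move=> ig; have := integrable_norm ig. Qed.

Lemma rintegrable_cst a : rintegrable (cst a).
Proof.
by apply: finite_measure_integrable_cst.
Qed.

Lemma eq_rintegrable g h : (forall z, g z = h z) -> rintegrable g -> rintegrable h.
Proof. by move=> /funext ->. Qed.

Definition cintegrable w :=
  rintegrable (fun z => complex.Re (w z)) /\ rintegrable (fun z => complex.Im (w z)).

Lemma cintegrable_measurable w : cintegrable w -> cmeasurable w.
Proof. by case=> /rintegrable_measurable ? /rintegrable_measurable. Qed.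

Lemma cmeasurableD w v : cmeasurable w -> cmeasurable v ->
  cmeasurable (fun z => w z + v z).
Proof.
case=> wr wi [vr vi]; split.
  rewrite (_ : (fun z => _) = (fun z => complex.Re (w z) + complex.Re (v z))).
    exact: measurable_funD.
  by apply/funext => z; case: (w z) => ? ?; case: (v z).
rewrite (_ : (fun z => _) = (fun z => complex.Im (w z) + complex.Im (v z))).
  exact: measurable_funD.
by apply/funext => z; case: (w z) => ? ?; case: (v z).
Qed.

Lemma cmeasurableM w v : cmeasurable w -> cmeasurable v ->
  cmeasurable (fun z => w z * v z).
Proof.
case=> wr wi [vr vi]; split.
  rewrite (_ : (fun z => _) = (fun z => complex.Re (w z) * complex.Re (v z) -
    complex.Im (w z) * complex.Im (v z))).
    by apply: measurable_funB; exact: measurable_funM.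
  by apply/funext => z; case: (w z) => ? ?; case: (v z).
rewrite (_ : (fun z => _) = (fun z => complex.Re (w z) * complex.Im (v z) +
    complex.Im (w z) * complex.Re (v z))).
  by apply: measurable_funD; exact: measurable_funM.
by apply/funext => z; case: (w z) => ? ?; case: (v z).
Qed.

Lemma cmeasurable_cst a : cmeasurable (fun=> a : C).
Proof. by split; exact: measurable_cst. Qed.

Lemma cmeasurableJ w : cmeasurable w -> cmeasurable (fun z => Num.conj (w z)).
Proof.
case=> wr wi; split.
  by rewrite (_ : (fun z => _) = (fun z => complex.Re (w z)))//; apply/funext => z; rewrite conjE.
rewrite (_ : (fun z => _) = (fun z => - complex.Im (w z))).
  exact: measurableT_comp.
by apply/funext => z; rewrite conjE.
Qed.

Lemma cmeasurable_sum (J : Type) (s : seq J) (f : J -> T -> C) :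
  (forall j, cmeasurable (f j)) -> cmeasurable (fun z => \sum_(j <- s) f j z).
Proof.
move=> mf; elim: s => [|j s ih].
  rewrite (_ : (fun z => _) = (fun=> 0)); first exact: cmeasurable_cst.
  by apply/funext => z; rewrite big_nil.
rewrite (_ : (fun z => _) = (fun z => f j z + \sum_(j <- s) f j z)).
  exact: cmeasurableD.
by apply/funext => z; rewrite big_cons.
Qed.

Lemma normRe_le (a : C) (r : R) : 0 <= r -> nsq a <= r ^+ 2 -> `|complex.Re a| <= r.
Proof.
move=> r0 h; rewrite -(@ler_pXn2r _ 2)// real_normK ?num_real//.
by apply: le_trans h; rewrite lerDl sqr_ge0.
Qed.

Lemma normIm_le (a : C) (r : R) : 0 <= r -> nsq a <= r ^+ 2 -> `|complex.Im a| <= r.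
Proof.
move=> r0 h; rewrite -(@ler_pXn2r _ 2)// real_normK ?num_real//.
by apply: le_trans h; rewrite lerDr sqr_ge0.
Qed.

Lemma cintegrable_le w g : cmeasurable w -> rintegrable g ->
  (forall z, 0 <= g z) -> (forall z, nsq (w z) <= g z ^+ 2) -> cintegrable w.
Proof.
move=> [wr wi] ig g0 wg; split.
  by apply: (rintegrable_le wr ig) => z; apply: normRe_le.
by apply: (rintegrable_le wi ig) => z; apply: normIm_le.
Qed.

Lemma cintegrable_majorant w : cintegrable w ->
  exists g, [/\ rintegrable g, forall z, 0 <= g z & forall z, nsq (w z) <= g z ^+ 2].
Proof.
move=> [wr wi]; exists (fun z => `|complex.Re (w z)| + `|complex.Im (w z)|); split.
- by apply: rintegrableD; exact: rintegrable_norm.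
- by move=> z; rewrite addr_ge0.
move=> z; rewrite sqrrD !real_normK ?num_real// /nsq -addrA lerD2l lerDr.
by rewrite mulrn_wge0// mulr_ge0.
Qed.

Lemma cintegrableM w v (M : R) : cintegrable w -> cmeasurable v ->
  (forall z, nsq (v z) <= M ^+ 2) -> cintegrable (fun z => v z * w z).
Proof.
move=> iw mv vM; have [g [ig g0 wg]] := cintegrable_majorant iw.
apply: (@cintegrable_le _ (fun z => `|M| * g z)).
- by apply: cmeasurableM => //; exact: cintegrable_measurable.
- exact: rintegrableZ.
- by move=> z; rewrite mulr_ge0.
move=> z; rewrite nsqM exprMn real_normK ?num_real//.
by rewrite ler_pM ?nsq_ge0.
Qed.

Lemma cintegrableD w v : cintegrable w -> cintegrable v ->
  cintegrable (fun z => w z + v z).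
Proof.
move=> [wr wi] [vr vi]; split.
  by apply: eq_rintegrable (rintegrableD wr vr) => z; case: (w z) => ? ?; case: (v z).
by apply: eq_rintegrable (rintegrableD wi vi) => z; case: (w z) => ? ?; case: (v z).
Qed.

Lemma cintegrableZ a w : cintegrable w -> cintegrable (fun z => a * w z).
Proof.
move=> iw; apply: (@cintegrableM _ (fun=> a) (nsq a + 1)) => //.
by move=> z; have := nsq_ge0 a; nra.
Qed.

Lemma RintD g h : rintegrable g -> rintegrable h ->
  Rintegral m setT (fun z => g z + h z) = Rintegral m setT g + Rintegral m setT h.
Proof. exact: RintegralD. Qed.

Lemma RintZ a g : rintegrable g ->
  Rintegral m setT (fun z => a * g z) = a * Rintegral m setT g.
Proof. by move=> ig; apply: RintegralZl. Qed.

Lemma cintegralD w v : cintegrable w -> cintegrable v ->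
  cintegral (fun z => w z + v z) = cintegral w + cintegral v.
Proof.
move=> [wr wi] [vr vi]; rewrite /cintegral; apply/eqP; rewrite eq_complex /=.
rewrite -!RintD//; apply/andP; split; apply/eqP; apply: eq_Rintegral => z _.
  by case: (w z) => ? ?; case: (v z).
by case: (w z) => ? ?; case: (v z).
Qed.

Lemma cintegralZ a w : cintegrable w ->
  cintegral (fun z => a * w z) = a * cintegral w.
Proof.
move=> [wr wi]; rewrite /cintegral; apply/eqP; rewrite eq_complex /=.
case: a => a b /=.
rewrite -!RintZ// -mulN1r -RintZ; last exact: rintegrableZ.
rewrite -!RintD; try by do ?apply: rintegrableZ.
apply/andP; split; apply/eqP; apply: eq_Rintegral => z _.
  by case: (w z) => ? ? /=; ring.
by case: (w z) => ? ? /=; ring.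
Qed.

Lemma cintegralJ w : cintegrable w ->
  cintegral (fun z => Num.conj (w z)) = Num.conj (cintegral w).
Proof.
move=> [wr wi]; rewrite /cintegral conjE; apply/eqP; rewrite eq_complex /=.
rewrite -[- Rintegral _ _ _]mulN1r -RintZ//.
by apply/andP; split; apply/eqP; apply: eq_Rintegral => z _; rewrite conjE//= mulN1r.
Qed.

Lemma eq_cintegral w v : (forall z, w z = v z) -> cintegral w = cintegral v.
Proof. by move=> /funext ->. Qed.

Lemma ae_eq_Rint g h : measurable_fun setT g -> measurable_fun setT h ->
  {ae m, forall z, g z = h z} -> Rintegral m setT g = Rintegral m setT h.
Proof.
move=> mg mh gh; congr fine; apply: ae_eq_integral => //.
- exact/measurable_EFinP.
- exact/measurable_EFinP.
by apply: filterS gh => z -> _.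
Qed.

Lemma ae_eq_cintegral w v : cmeasurable w -> cmeasurable v ->
  {ae m, forall z, w z = v z} -> cintegral w = cintegral v.
Proof.
move=> [wr wi] [vr vi] wv; rewrite /cintegral.
by congr (_ +i* _); apply: ae_eq_Rint => //; apply: filterS wv => z ->.
Qed.

Lemma cintegral_real g : rintegrable g ->
  cintegral (fun z => (g z)%:C) = (Rintegral m setT g)%:C.
Proof.
by move=> ig; rewrite /cintegral /= /Rintegral integral0.
Qed.

End ComplexIntegral.

(** * The measure of the circle: conjugation and moments *)

Section CircleMeasure.
Context {R : realType}.
Local Notation T := (circle R).
Local Notation m := (@circle_measure R).
Local Notation C := R[i].
Local Notation mu := (@lebesgue_measure R).

Lemma circle_measureT : m setT = 1%E.
Proof. exact: (@probability_setT _ _ _ m). Qed.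

Lemma Rintegral_circle_cst (a : R) : Rintegral m setT (fun=> a) = a.
Proof.
transitivity (a * fine (m setT)); first exact: Rintegral_cst.
by rewrite circle_measureT mulr1.
Qed.

Lemma measurable_circle_coord : measurable_fun [set: T] (@circle_coord R).
Proof. by move=> _ B mB; exists B. Qed.

Lemma measurable_circle_Re : measurable_fun [set: T] (fun z => complex.Re (val z)).
Proof.
exact: (measurableT_comp measurable_fst measurable_circle_coord).
Qed.

Lemma measurable_circle_Im : measurable_fun [set: T] (fun z => complex.Im (val z)).
Proof.
exact: (measurableT_comp measurable_snd measurable_circle_coord).
Qed.

Lemma measurable_circle_conj : measurable_fun [set: T] (@circle_conj R).
Proof.
move=> _ _ [B mB <-]; rewrite !setTI -comp_preimage -[X in measurable X]setTI.
rewrite (_ : _ \o _ = fun z => (complex.Re (val z), - complex.Im (val z))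
    : measurableTypeR R * measurableTypeR R); last first.
  by apply/funext => -[[a b] h]; rewrite /circle_coord /=.
apply: (@measurable_fun_pair _ _ _ T (measurableTypeR R) (measurableTypeR R)
  (fun z => complex.Re (val z)) (fun z => - complex.Im (val z))) => //.
  exact: measurable_circle_Re.
by apply: measurableT_comp => //; exact: measurable_circle_Im.
Qed.

(** Both measures give a half-open interval its length. *)
Lemma lebesgue_measure_reflect (c : R) (A : set (measurableTypeR R)) :
  measurable A -> mu ((fun t => c - t) @^-1` A) = mu A.
Proof.
move=> mA.
pose phi := (fun t => c - t) : measurableTypeR R -> measurableTypeR R.
have mphi : measurable_fun setT phi by apply: measurable_funB.
rewrite -[LHS]/(pushforward mu phi A).
apply/esym/lebesgue_measure_unique => //= _ [[a b] _ <-] /=.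
rewrite /pushforward.
rewrite (_ : phi @^-1` _ = `[c - b, c - a[%classic); last first.
  by apply/seteqP; split => t /=; rewrite !in_itv /= /phi; lra.
rewrite !lebesgue_measure_itv /= !lte_fin ltrD2l ltrN2.
by case: ifP => // _; congr (_%:E); ring.
Qed.

Lemma measurable_period :
  measurable [set t : measurableTypeR R | 0 <= t <= pi *+ 2].
Proof. by rewrite -set_itvcc; exact: measurable_itv. Qed.

Lemma circle_measureE (A : set T) : measurable A ->
  m A = (((pi *+ 2)^-1)%R%:E *
    mu (@expi R @^-1` A `&` ([set t : measurableTypeR R | 0 <= t <= pi *+ 2])%R))%E.
Proof.
move=> mA; rewrite -[LHS]/(\int[mu]_(x in @expi R @^-1` A) (uniform_pdf 0 (pi *+ 2) x)%:E)%E.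
rewrite integral_uniform_pdf set_itvcc (eq_integral (cst (pi *+ 2)^-1%:E)).
  rewrite integral_cst//; apply: measurableI; last exact: measurable_period.
  by rewrite -[X in measurable X]setTI; exact: measurable_expi.
by move=> t; rewrite inE /= => -[_ h]; rewrite /uniform_pdf h subr0.
Qed.

(** On [[0, 2 pi]] conjugation is the reflection [t |-> 2 pi - t]. *)
Lemma circle_measure_conj (A : set T) : measurable A ->
  m (@circle_conj R @^-1` A) = m A.
Proof.
move=> mA; rewrite !circle_measureE//; last first.
  by rewrite -[X in measurable X]setTI; exact: measurable_circle_conj.
congr (_ * _)%E.
have mB : measurable (@expi R @^-1` A `&` [set t : measurableTypeR R | 0 <= t <= pi *+ 2]).
  apply: measurableI; last exact: measurable_period.
  by rewrite -[X in measurable X]setTI; exact: measurable_expi.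
rewrite -(lebesgue_measure_reflect (pi *+ 2) mB); congr (mu _).
apply/seteqP; split => t /=.
  move=> [h h2]; split; last by lra.
  suff -> : expi (pi *+ 2 - t) = circle_conj (expi t) by [].
  by apply/val_inj; rewrite /= conjE /= cosB sinB cos2pi sin2pi; congr (_ +i* _); ring.
move=> [h h2]; split; last by lra.
suff <- : expi (pi *+ 2 - t) = circle_conj (expi t) by [].
by apply/val_inj; rewrite /= conjE /= cosB sinB cos2pi sin2pi; congr (_ +i* _); ring.
Qed.

Lemma ge0_integral_circle_conj (f : T -> \bar R) : measurable_fun setT f ->
  (forall z, 0 <= f z)%E -> (\int[m]_z f (circle_conj z) = \int[m]_z f z)%E.
Proof.
move=> mf f0.
rewrite -[LHS](@ge0_integral_pushforward _ _ _ _ _ _ measurable_circle_conj m setT f)//.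
by apply: eq_measure_integral; [exact: measurable_circle_conj|move=> ? A mA _; exact: circle_measure_conj].
Qed.

Lemma rintegrable_conj (g : T -> R) : rintegrable g ->
  rintegrable (fun z => g (circle_conj z)).
Proof.
move=> /integrableP[mg ig]; apply/integrableP; split.
  by have := measurableT_comp mg measurable_circle_conj.
rewrite /= (ge0_integral_circle_conj (f := fun z => `|(g z)%:E|%E))//.
exact: measurableT_comp.
Qed.

Lemma Rintegral_conj (g : T -> R) : rintegrable g ->
  Rintegral m setT (fun z => g (circle_conj z)) = Rintegral m setT g.
Proof.
move=> ig; congr fine.
have mg : measurable_fun setT (EFin \o g) by exact: measurable_int ig.
rewrite -[LHS](@integral_pushforward _ _ _ _ _ _ measurable_circle_conj m setT (EFin \o g))//.
  by apply: eq_measure_integral; [exact: measurable_circle_conj|move=> ? A mA _; exact: circle_measure_conj].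
exact: rintegrable_conj.
Qed.

Lemma cintegral_conj (w : T -> C) : cintegrable w ->
  cintegral (fun z => w (circle_conj z)) = cintegral w.
Proof.
case=> wr wi; rewrite /cintegral.
by congr (_ +i* _); [exact: Rintegral_conj wr|exact: Rintegral_conj wi].
Qed.

Lemma ae_circle_conj (P : T -> Prop) : {ae m, forall z, P z} ->
  {ae m, forall z, P (circle_conj z)}.
Proof.
move=> [N [mN N0 PN]]; exists (@circle_conj R @^-1` N); split.
- by rewrite -[X in measurable X]setTI; exact: measurable_circle_conj.
- by rewrite -N0; exact: circle_measure_conj.
by move=> z hz; exact: PN.
Qed.

Lemma circle_conjK : involutive (@circle_conj R).
Proof. by move=> z; apply/val_inj; rewrite /= conjCK. Qed.

Lemma nsq_circle (z : T) : nsq (val z) = 1.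
Proof.
have /eqP h := valP z.
by have := add_Re2_Im2 (val z); rewrite h expr1n => -[].
Qed.

Lemma circle_neq0 (z : T) : val z != 0.
Proof.
by apply/eqP => h; have := nsq_circle z; rewrite h nsq0 => /eqP; rewrite eq_sym oner_eq0.
Qed.

Lemma circle_inv (z : T) : (val z)^-1 = Num.conj (val z).
Proof.
apply: (mulfI (circle_neq0 z)); rewrite divff ?circle_neq0// mulJE nsq_circle.
by [].
Qed.

Lemma circle_conjX (z : T) (n : int) : Num.conj (val z ^ n) = val z ^ (- n).
Proof. by rewrite rmorphXz ?unitfE ?circle_neq0//= -circle_inv exprz_inv. Qed.

Lemma nsqX (z : T) (n : int) : nsq (val z ^ n) = 1.
Proof.
have h : (nsq (val z ^ n))%:C = 1%:C :> C.
  by rewrite -mulJE circle_conjX -expfzDr ?circle_neq0// subrr.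
exact: complexI h.
Qed.

Lemma cmeasurable_circle : @cmeasurable R (fun z => val z).
Proof. by split; [exact: measurable_circle_Re|exact: measurable_circle_Im]. Qed.

Lemma cmeasurableX (n : int) : @cmeasurable R (fun z => val z ^ n).
Proof.
have nat_case (k : nat) : @cmeasurable R (fun z => val z ^+ k).
  elim: k => [|k ih]; first exact: cmeasurable_cst.
  rewrite (_ : (fun _ => _) = (fun z : T => val z * val z ^+ k)).
    by apply: cmeasurableM => //; exact: cmeasurable_circle.
  by apply/funext => z; rewrite exprS.
case: n => k; first exact: nat_case.
rewrite (_ : (fun _ => _) = (fun z : T => Num.conj (val z ^+ k.+1))).
  exact: cmeasurableJ.
by apply/funext => z; rewrite NegzE -circle_conjX.
Qed.

Lemma cintegrableX (w : T -> C) (n : int) : cintegrable w ->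
  cintegrable (fun z => val z ^ n * w z).
Proof.
move=> iw; apply: (@cintegrableM _ _ _ 1) => //; first exact: cmeasurableX.
by move=> z; rewrite nsqX expr1n.
Qed.

Lemma cintegrable_cst (a : C) : @cintegrable R (fun=> a).
Proof. by split; exact: rintegrable_cst. Qed.

Lemma expiX (t : R) n : val (expi t) ^+ n = cos (n%:R * t) +i* sin (n%:R * t) :> C.
Proof.
elim: n => [|n ih]; first by rewrite expr0 mul0r cos0 sin0.
rewrite exprS ih /= -natr1 mulrDl mul1r cosD sinD.
by apply/eqP; rewrite eq_complex /=; apply/andP; split; apply/eqP; ring.
Qed.

(** The constant [1] makes the integrand nonnegative, so that this integral is
    also the one of [1 + Re z^n] over the circle by a formula for nonnegative
    functions. *)
Lemma integral_cos (n : nat) : (0 < n)%N ->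
  (\int[mu]_(t in `[0%R, (pi *+ 2)%R]) (1 + cos (n%:R * t))%R%:E =
    ((pi *+ 2)%R : R)%:E)%E.
Proof.
move=> n0; have nn : n%:R != 0 :> R by rewrite pnatr_eq0 -lt0n.
have dF (t : R) : is_derive t (1:R) (fun t : R => t + n%:R^-1 * sin (n%:R * t)) (1 + cos (n%:R * t)).
  apply: is_derive_eq.
  by rewrite /GRing.scale /= mulr1 mulrCA mulVf// mulr1.
have cF : continuous (fun t : R => t + n%:R^-1 * sin (n%:R * t)).
  by move=> t; apply/differentiable_continuous/derivable1_diffP; have [] := dF t.
rewrite (@continuous_FTC2 _ _ (fun t : R => t + n%:R^-1 * sin (n%:R * t))).
- have s0 : sin (n%:R * (pi *+ 2)) = 0 :> R.
    by have := periodicn (@sinD2pi R) n 0; rewrite add0r sin0 mulr_natl.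
  by rewrite s0 !mulr0 sin0 mulr0 !addr0 -EFinB subr0.
- by rewrite mulrn_wgt0 ?pi_gt0.
- apply: continuous_subspaceT => t; apply: cvgD; first exact: cvg_cst.
  by apply: continuous_comp; [exact: mulrl_continuous|exact: continuous_cos].
- split => [t _||].
  + by have [] := dF t.
  + by apply: cvg_at_right_filter; exact: cF.
  + by apply: cvg_at_left_filter; exact: cF.
by move=> t _; rewrite derive1E; have [_ ->] := dF t.
Qed.

Lemma circle_conj_val (z : T) (n : int) : val (circle_conj z) ^ n = Num.conj (val z ^ n).
Proof. by rewrite rmorphXz ?unitfE ?circle_neq0. Qed.

Lemma Rintegral_Re_moment (n : nat) : (0 < n)%N ->
  Rintegral m setT (fun z : T => complex.Re (val z ^+ n)) = 0.
Proof.
move=> n0.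
have ir : @rintegrable R (fun z => complex.Re (val z ^+ n)).
  have := cintegrableX n%:Z (cintegrable_cst 1); case=> h _.
  by apply: eq_rintegrable h => z; rewrite mulr1.
have bound (z : T) : `|complex.Re (val z ^+ n)| <= 1.
  by apply: normRe_le => //; rewrite (nsqX z n) expr1n.
have pos (z : T) : 0 <= 1 + complex.Re (val z ^+ n).
  by have := bound z; rewrite ler_norml; lra.
have h : Rintegral m setT (fun z : T => 1 + complex.Re (val z ^+ n)) = 1.
  rewrite /Rintegral.
  have mf : measurable_fun [set: T] (fun z : T => (1 + complex.Re (val z ^+ n))%:E).
    apply/measurable_EFinP; apply: measurable_funD => //.
    exact: rintegrable_measurable ir.
  rewrite ge0_integral_distribution//.
  rewrite integral_uniform.
  - under eq_integral do rewrite /= -/(expi _) expiX /=.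
    rewrite integral_cos// subr0 /= mulVf// gt_eqF// mulrn_wgt0// pi_gt0//.
  - exact: measurableT_comp.
  - by move=> t; rewrite lee_fin.
move: h; rewrite RintD//; last exact: rintegrable_cst.
rewrite Rintegral_circle_cst; lra.
Qed.

(** Conjugation changes the sign of the integrand. *)
Lemma Rintegral_Im_moment (n : nat) :
  Rintegral m setT (fun z : T => complex.Im (val z ^+ n)) = 0.
Proof.
have ir : @rintegrable R (fun z => complex.Im (val z ^+ n)).
  have := cintegrableX n%:Z (cintegrable_cst 1); case=> _ h.
  by apply: eq_rintegrable h => z; rewrite mulr1.
have := Rintegral_conj ir.
have -> : (fun z : T => complex.Im (val (circle_conj z) ^+ n)) =
    (fun z => -1 * complex.Im (val z ^+ n)).
  apply/funext => z.
  by rewrite -[_ ^+ n]/(val (circle_conj z) ^ n) circle_conj_val conjE /= mulN1r.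
by rewrite RintZ//; lra.
Qed.

Lemma cintegral_moment (n : int) : @cintegral R (fun z => val z ^ n) = (n == 0)%:R.
Proof.
have nat_case (k : nat) : (0 < k)%N -> @cintegral R (fun z => val z ^+ k) = 0.
  by move=> k0; rewrite /cintegral Rintegral_Re_moment// Rintegral_Im_moment.
case: n => k.
  case: k => [|k]; last by rewrite -[RHS](nat_case k.+1).
  by rewrite /cintegral /= !Rintegral_circle_cst.
rewrite (_ : (fun z => _) = (fun z : T => Num.conj (val z ^ k.+1%:Z))); last first.
  by apply/funext => z; rewrite NegzE circle_conjX.
rewrite cintegralJ; first by rewrite nat_case// conjC0.
have := cintegrableX k.+1%:Z (cintegrable_cst 1).
by under eq_fun do rewrite mulr1.
Qed.

End CircleMeasure.

(** * Uniqueness of Fourier coefficients *)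

Section FourierUniqueness.
Context {R : realType}.
Local Notation T := (circle R).
Local Notation m := (@circle_measure R).
Local Notation C := R[i].

(** The integrable functions all of whose Fourier coefficients vanish; the aim
    is to show that they vanish almost everywhere. *)
Definition null_moments (w : T -> C) :=
  cintegrable w /\ forall n : int, cintegral (fun z => val z ^ n * w z) = 0.

(** The bounded functions that preserve [null_moments] by multiplication.
    Since this is a stability property, they form an algebra; it is closed
    under bounded pointwise limits by dominated convergence. *)
Definition multiplier (phi : T -> R) :=
  [/\ measurable_fun setT phi, exists M, forall z, `|phi z| <= M &
      forall w, null_moments w -> null_moments (fun z => (phi z)%:C * w z)].

Lemma null_momentsD w v : null_moments w -> null_moments v ->
  null_moments (fun z => w z + v z).
Proof.
move=> [iw wn] [iv vn]; split; first exact: cintegrableD.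
move=> n; rewrite (_ : (fun z => _) = fun z : T => val z ^ n * w z + val z ^ n * v z).
  by rewrite cintegralD ?wn ?vn ?addr0//; exact: cintegrableX.
by apply/funext => z; rewrite mulrDr.
Qed.

Lemma null_momentsZ a w : null_moments w -> null_moments (fun z => a * w z).
Proof.
move=> [iw wn]; split; first exact: cintegrableZ.
move=> n; rewrite (_ : (fun z => _) = fun z : T => a * (val z ^ n * w z)).
  by rewrite cintegralZ ?wn ?mulr0//; exact: cintegrableX.
by apply/funext => z; rewrite mulrCA.
Qed.

Lemma null_momentsX k w : null_moments w -> null_moments (fun z => val z ^ k * w z).
Proof.
move=> [iw wn]; split; first exact: cintegrableX.
move=> n; rewrite (_ : (fun z => _) = fun z : T => val z ^ (n + k) * w z) ?wn//.
by apply/funext => z; rewrite mulrA -expfzDr// circle_neq0.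
Qed.

Lemma eq_null_moments w v : (forall z, w z = v z) -> null_moments w -> null_moments v.
Proof. by move=> /funext ->. Qed.

Lemma multiplierM phi psi : multiplier phi -> multiplier psi ->
  multiplier (fun z => phi z * psi z).
Proof.
move=> [mphi [M phiM] hphi] [mpsi [N psiN] hpsi]; split.
- exact: measurable_funM.
- by exists (M * N) => z; rewrite normrM ler_pM.
move=> w hw; apply: eq_null_moments (hphi _ (hpsi _ hw)) => z.
by rewrite mulrA -rmorphM.
Qed.

Lemma multiplierD phi psi : multiplier phi -> multiplier psi ->
  multiplier (fun z => phi z + psi z).
Proof.
move=> [mphi [M phiM] hphi] [mpsi [N psiN] hpsi]; split.
- exact: measurable_funD.
- by exists (M + N) => z; rewrite (le_trans (ler_normD _ _))// lerD.
move=> w hw; apply: eq_null_moments (null_momentsD (hphi _ hw) (hpsi _ hw)) => z.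
by rewrite -mulrDl -rmorphD.
Qed.

Lemma multiplier_cst a : multiplier (fun=> a).
Proof.
split; first exact: measurable_cst.
  by exists `|a|.
by move=> w; exact: null_momentsZ.
Qed.

Lemma multiplierZ a phi : multiplier phi -> multiplier (fun z => a * phi z).
Proof. by move=> h; exact: multiplierM (multiplier_cst a) h. Qed.

Lemma eq_multiplier phi psi : (forall z, phi z = psi z) -> multiplier phi -> multiplier psi.
Proof. by move=> /funext ->. Qed.

(** [Re z] is [(z + z^-1) / 2] on the circle, and multiplication by powers of
    [z] shifts the moments. *)
Lemma multiplier_Re : multiplier (fun z => complex.Re (val z)).
Proof.
split; first exact: measurable_circle_Re.
  by exists 1 => z; apply: normRe_le; rewrite ?nsq_circle// expr1n.
move=> w hw.
have h1 := null_momentsX 1 hw; have h2 := null_momentsX (-1) hw.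
apply: eq_null_moments (null_momentsZ (2^-1)%:C (null_momentsD h1 h2)) => z.
rewrite -circle_conjX expr1z conjE -mulrDl mulrA; congr (_ * _).
by case: (val z) => a b; apply/eqP; rewrite eq_complex /=; apply/andP; split; apply/eqP; field.
Qed.

Lemma multiplier_Im : multiplier (fun z => complex.Im (val z)).
Proof.
split; first exact: measurable_circle_Im.
  by exists 1 => z; apply: normIm_le; rewrite ?nsq_circle// expr1n.
move=> w hw.
have h1 := null_momentsX 1 hw; have h2 := null_momentsZ (-1) (null_momentsX (-1) hw).
apply: eq_null_moments (null_momentsZ (0 -i* 2^-1) (null_momentsD h1 h2)) => z.
rewrite -circle_conjX expr1z conjE mulrA -mulrDl mulrA; congr (_ * _).
by case: (val z) => a b; apply/eqP; rewrite eq_complex /=; apply/andP; split; apply/eqP; field.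
Qed.

Lemma Rintegral_lim0 (g : T -> R) (phi_ : nat -> T -> R) (phi : T -> R) (M : R) :
  rintegrable g -> (forall k, measurable_fun setT (phi_ k)) ->
  (forall k z, `|phi_ k z| <= M) ->
  (forall z, phi_ ^~ z @ \oo --> phi z) ->
  (forall k, Rintegral m setT (fun z => phi_ k z * g z) = 0) ->
  Rintegral m setT (fun z => phi z * g z) = 0.
Proof.
move=> ig mphi phiM phil h.
have mg := rintegrable_measurable ig.
have ik k : rintegrable (fun z => phi_ k z * g z).
  apply: (rintegrable_le _ (rintegrableZ M (rintegrable_norm ig))).
    exact: measurable_funM.
  by move=> z; rewrite normrM ler_wpM2r.
have [] := @dominated_convergence _ T R m setT measurableT
  (fun k z => (phi_ k z * g z)%:E) (fun z => (phi z * g z)%:E) (fun z => (M * `|g z|)%:E).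
- by move=> k; apply/measurable_EFinP; exact: measurable_funM.
- apply/measurable_EFinP; apply: measurable_funM => //.
  by apply: (@measurable_fun_cvg _ _ _ setT phi_) => // z _.
- by apply: aeW => z _; apply: cvg_EFin; [exact: nearW | apply: cvgM => //; exact: cvg_cst].
- exact: rintegrableZ (rintegrable_norm ig).
- by apply: aeW => z k _; rewrite abse_EFin lee_fin normrM ler_wpM2r.
move=> _ _ /=.
rewrite (_ : (fun k => _) = fun=> 0%E); last first.
  apply/funext => k; rewrite -[LHS]fineK; last exact: integrable_fin_num (ik k).
  by congr EFin; exact: h.
by move=> /cvg_lim; rewrite lim_cst// /Rintegral => <-.
Qed.

(** All moments are integrals of a fixed integrable function against [phi_ k],
    hence pass to the limit. *)
Lemma multiplier_lim (phi_ : nat -> T -> R) (phi : T -> R) (M : R) :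
  (forall k, multiplier (phi_ k)) -> (forall k z, `|phi_ k z| <= M) ->
  (forall z, phi_ ^~ z @ \oo --> phi z) -> multiplier phi.
Proof.
move=> mphi phiM phil.
have mm k : measurable_fun setT (phi_ k) by case: (mphi k).
have bd z : `|phi z| <= M.
  by apply: (@closed_cvg _ _ \oo _ (fun k => `|phi_ k z|) (fun x => x <= M)); [exact: closed_le|exact: nearW|exact: cvg_norm].
have mp : measurable_fun setT phi.
  by apply: (@measurable_fun_cvg _ _ _ setT phi_) => // z _.
split => //; first by exists M.
move=> w hw; split.
  apply: (@cintegrableM _ _ _ M); first exact: hw.1.
    by split => /=; [exact: mp|exact: measurable_cst].
  move=> z; rewrite /nsq /= expr0n addr0 -(real_normK (num_real (phi z))).
  by rewrite lerXn2r// nnegrE (le_trans _ (bd z)).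
move=> n; have [iR iI] := cintegrableX n hw.1.
have E (psi : T -> R) : cintegral (fun z => val z ^ n * ((psi z)%:C * w z)) =
    Rintegral m setT (fun z => psi z * complex.Re (val z ^ n * w z)) +i*
    Rintegral m setT (fun z => psi z * complex.Im (val z ^ n * w z)).
  rewrite /cintegral; congr (_ +i* _); apply: eq_Rintegral => z _; rewrite mulrCA;
  by case: (val z ^ n * w z) => a b /=; ring.
have h k := E (phi_ k).
have {}h k : Rintegral m setT (fun z => phi_ k z * complex.Re (val z ^ n * w z)) = 0 /\
    Rintegral m setT (fun z => phi_ k z * complex.Im (val z ^ n * w z)) = 0.
  by have [_ _ /(_ _ hw)[_ /(_ n)]] := mphi k; rewrite h => -[].
rewrite E (Rintegral_lim0 iR mm phiM phil) ?(Rintegral_lim0 iI mm phiM phil)//.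
  by move=> k; case: (h k).
by move=> k; case: (h k).
Qed.

(** An odd polynomial that maps [[-1, 1]] to itself, with [0], [1] and [-1] as
    fixed points, the last two attracting. *)
Definition sgn_step (x : R) : R := (3 * x - x ^+ 3) / 2.

(** For [0 < x <= 1] the iterates stay above [x], and the distance to [1] is
    multiplied by [1 - t (1 + t) / 2 <= 1 - x / 2] at each step [t]. *)
Lemma sgn_step_cvg (x : R) : `|x| <= 1 ->
  (forall k, `|iter k sgn_step x| <= 1) /\
  (fun k => iter k sgn_step x) @ \oo --> Num.sg x.
Proof.
have pos (y : R) : 0 < y -> y <= 1 -> forall k,
    y <= iter k sgn_step y <= 1 /\ 1 - iter k sgn_step y <= (1 - y / 2) ^+ k.
  move=> y0 y1; elim => [|k [/andP[ih1 ih2] ih3]] /=.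
    by rewrite expr0 lexx y1; split => //; lra.
  set t := iter k sgn_step y in ih1 ih2 ih3 *.
  have e : 1 - sgn_step t = (1 - t) * (1 - t * (1 + t) / 2).
    by rewrite /sgn_step; field.
  have h1 : 0 <= 1 - t * (1 + t) / 2 <= 1 - y / 2 by apply/andP; split; nra.
  have e2 : sgn_step t - t = t * (1 - t) * (1 + t) / 2 by rewrite /sgn_step; field.
  have h2 : 0 <= t * (1 - t) * (1 + t) / 2.
    by rewrite divr_ge0// !mulr_ge0//; lra.
  have h3 : 0 <= (1 - t) * (1 - t * (1 + t) / 2).
    by rewrite mulr_ge0//; [lra | case/andP: h1].
  split; first by apply/andP; split; lra.
  rewrite e exprSr ler_pM//; [lra | by case/andP: h1 | by case/andP: h1].
have cvg (y : R) : 0 < y -> y <= 1 -> (fun k => iter k sgn_step y) @ \oo --> (1:R).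
  move=> y0 y1.
  apply/cvgrPdist_le => eps eps0.
  have cv : (fun k => (1 - y / 2) ^+ k) @ \oo --> (0 : R).
    by apply: cvg_expr; rewrite ger0_norm; lra.
  have /cvgrPdist_le/(_ _ eps0) := cv; apply: filterS => k.
  rewrite sub0r normrN ger0_norm; last by rewrite exprn_ge0//; lra.
  have [/andP[_ h1] h2] := pos y y0 y1 k.
  by move=> h3; rewrite ger0_norm ?subr_ge0// (le_trans h2).
have odd (y : R) k : iter k sgn_step (- y) = - iter k sgn_step y.
  by elim: k => //= k ->; rewrite /sgn_step; field.
have it0 k : iter k sgn_step 0 = 0.
  by elim: k => //= k ->; rewrite /sgn_step; field.
rewrite ler_norml => /andP[xl xr]; have [x0|x0|->] := ltgtP x 0.
- have x0' : 0 < - x by lra.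
  have x1' : - x <= 1 by lra.
  split.
    move=> k; rewrite -[x]opprK odd normrN ger0_norm; have [/andP[h1 h2] _] := pos _ x0' x1' k; lra.
  rewrite ltr0_sg// -[x]opprK; under eq_fun do rewrite odd.
  by apply: cvgN; exact: cvg.
- split.
    by move=> k; have [/andP[h1 h2] _] := pos _ x0 xr k; rewrite ger0_norm//; lra.
  by rewrite gtr0_sg//; exact: cvg.
split; first by move=> k; rewrite it0 normr0.
by rewrite sgr0; under eq_fun do rewrite it0; exact: cvg_cst.
Qed.

(** The sign is a bounded limit of polynomials in a rescaled [phi]. *)
Lemma multiplier_sgn phi : multiplier phi -> multiplier (fun z => Num.sg (phi z)).
Proof.
move=> hphi; have [_ [M phiM] _] := hphi.
pose c := (`|M| + 1)^-1.
have c0 : 0 < c by rewrite invr_gt0; have := normr_ge0 M; lra.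
have hc z : `|c * phi z| <= 1.
  rewrite normrM (gtr0_norm c0) mulrC ler_pdivrMr; last first.
    by have := normr_ge0 M; lra.
  by rewrite mul1r; have := phiM z; have := ler_norm M; lra.
apply: (@multiplier_lim (fun k z => iter k sgn_step (c * phi z)) _ 1).
- elim => [|k ih]; first exact: multiplierZ.
  have ih3 := multiplierM ih (multiplierM ih ih).
  apply: eq_multiplier (multiplierD (multiplierZ (3 / 2) ih) (multiplierZ (- 2^-1) ih3)) => z /=.
  by rewrite /sgn_step; field.
- by move=> k z; have [] := sgn_step_cvg (hc z).
move=> z; have [_] := sgn_step_cvg (hc z).
by rewrite sgrM (gtr0_sg c0) mul1r.
Qed.

Lemma multiplier_gt0 phi : multiplier phi -> multiplier \1_[set z | 0 < phi z].
Proof.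
move=> /multiplier_sgn h.
apply: eq_multiplier (multiplierZ 2^-1 (multiplierD h (multiplierM h h))) => z.
rewrite indicE; case: (ltgtP (phi z) 0) => [p|p|p].
- rewrite ltr0_sg// memNset /=; first by ring.
  by apply/negP; rewrite -leNgt ltW.
- by rewrite gtr0_sg// mem_set//=; field.
- rewrite p sgr0 memNset /=; first by ring.
  by rewrite p ltxx.
Qed.

Definition multiplier_sets : set (set T) := [set B | multiplier \1_B].

(** Intersections are products of indicators and countable unions are bounded
    limits. *)
Lemma sigma_algebra_multiplier_sets : sigma_algebra setT multiplier_sets.
Proof.
split.
- by apply: eq_multiplier (multiplier_cst 0) => z; rewrite indic0.
- move=> A hA; apply: eq_multiplier (multiplierD (multiplier_cst 1) (multiplierZ (-1) hA)) => z.
  rewrite setTD !indicE in_setC; case: (z \in A) => /=; ring.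
move=> A hA.
have hU n : multiplier \1_(\bigcup_(k in `I_n) A k).
  elim: n => [|n ih].
    by apply: eq_multiplier (multiplier_cst 0) => z; rewrite II0 bigcup_set0 indic0.
  apply: eq_multiplier (multiplierD (multiplierD ih (hA n)) (multiplierZ (-1) (multiplierM ih (hA n)))) => z.
  rewrite IIS bigcup_setU bigcup_set1 !indicE in_setU.
  by case: (z \in _); case: (z \in _) => /=; ring.
apply: (@multiplier_lim _ _ 1 hU).
  by move=> k z; rewrite indicE; case: (_ \in _); rewrite /= ?normr1 ?normr0.
move=> z; rewrite indicE; have [zA|zA] := boolP (z \in \bigcup_k A k).
  move: (zA); rewrite inE => -[k _ Akz].
  apply: cvg_near_cst; exists k.+1 => // n /= kn.
  by rewrite indicE mem_set//; exists k.
apply: cvg_near_cst; apply: nearW => n; rewrite indicE memNset// => -[k _ Akz].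
by move: zA; rewrite notin_setE; apply; exists k.
Qed.

(** The two coordinates are measurable for the sigma-algebra
    [multiplier_sets], since their superlevel sets belong to it, and they
    generate the sigma-algebra of the circle. *)
Lemma measurable_multiplier_sets (B : set T) : measurable B -> multiplier_sets B.
Proof.
have half (phi : T -> measurableTypeR R) : multiplier phi ->
    @measurable_fun _ _ (g_sigma_algebraType multiplier_sets) (measurableTypeR R) setT phi.
  move=> hphi.
  apply: (measurability (@RGenOInfty.G R)).
    exact: RGenOInfty.measurableE.
  move=> _ [_ [a ->] <-]; apply: sub_sigma_algebra; rewrite /multiplier_sets /=.
  have := multiplier_gt0 (multiplierD hphi (multiplier_cst (- a))).
  congr (multiplier \1_ _).
  by apply/seteqP; split => z /=; rewrite in_itv /= andbT subr_gt0; tauto.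
have hc := @measurable_fun_pair _ _ _ (g_sigma_algebraType multiplier_sets)
  (measurableTypeR R) (measurableTypeR R) _ _ (half _ multiplier_Re) (half _ multiplier_Im).
move=> [Y mY <-].
have := hc measurableT _ mY.
by rewrite (measurable_g_measurableTypeE sigma_algebra_multiplier_sets).
Qed.

(** Uniqueness of Fourier coefficients: the integral of [w] over every
    measurable set vanishes. *)
Lemma null_moments_ae0 (w : T -> C) : null_moments w -> {ae m, forall z, w z = 0}.
Proof.
move=> hw; have [[wr wi] _] := hw.
have half (g : T -> R) : rintegrable g -> (forall B, measurable B ->
    Rintegral m setT (fun z => \1_B z * g z) = 0) -> {ae m, forall z, g z = 0}.
  move=> ig h.
  have : ae_eq m setT (EFin \o g) (cst 0%E).
    apply: (@integral_ae_eq _ T R m setT measurableT) => //.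
    move=> B _ mB; rewrite integral0.
    have iB : m.-integrable B (EFin \o g) by exact: integrableS ig.
    rewrite -[LHS]fineK; last exact: integrable_fin_num.
    congr EFin; rewrite -[RHS](h B mB) -[LHS]/(Rintegral m B g) Rintegral_mkcond.
    apply: eq_Rintegral => z _; rewrite patchE indicE.
    by case: (z \in B); rewrite ?mul1r ?mul0r.
  by apply: filterS => z /(_ I) [].
have key B : measurable B -> cintegral (fun z => (\1_B z : R)%:C * w z) = 0.
  move=> /measurable_multiplier_sets [_ _ /(_ _ hw)[_ /(_ 0)]].
  by under eq_fun do rewrite expr0z mul1r.
have hr : {ae m, forall z, complex.Re (w z) = 0}.
  apply: half => // B /key []; rewrite /cintegral => + _.
  move=> h; rewrite -[RHS]h; apply: eq_Rintegral => z _; case: (w z) => a b /=; ring.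
have hi : {ae m, forall z, complex.Im (w z) = 0}.
  apply: half => // B /key []; rewrite /cintegral => _ h.
  rewrite -[RHS]h; apply: eq_Rintegral => z _; case: (w z) => a b /=; ring.
apply: filterS2 hr hi => z /=; case: (w z) => a b /= -> ->.
by [].
Qed.

End FourierUniqueness.

(** * Square-integrable vector functions *)

Section SquareIntegrable.
Context {R : realType} (K : hilbertType R).
Local Notation T := (circle R).
Local Notation m := (@circle_measure R).
Local Notation C := R[i].
Implicit Types (f g : T -> K).

Lemma vmeasurable_lin a f g : vmeasurable f -> vmeasurable g ->
  vmeasurable (fun z => a *: f z + g z).
Proof.
move=> mf mg x.
rewrite (_ : (fun z => _) = fun z => a * dot (f z) x + dot (g z) x); last first.
  by apply/funext => z; rewrite dot_linearl.
by apply: cmeasurableD => //; apply: cmeasurableM => //; exact: cmeasurable_cst.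
Qed.

Lemma vmeasurable_cst (x : K) : vmeasurable (fun=> x).
Proof. by move=> y; exact: cmeasurable_cst. Qed.

Lemma vmeasurableZ (a : T -> C) f : cmeasurable a -> vmeasurable f ->
  vmeasurable (fun z => a z *: f z).
Proof.
move=> ma mf x.
rewrite (_ : (fun z => _) = fun z => a z * dot (f z) x).
  exact: cmeasurableM.
by apply/funext => z; rewrite dotZl.
Qed.

Lemma vmeasurableD f g : vmeasurable f -> vmeasurable g ->
  vmeasurable (fun z => f z + g z).
Proof.
move=> mf mg; have := vmeasurable_lin 1 mf mg.
by under eq_fun do rewrite scale1r.
Qed.

Lemma vmeasurableB f g : vmeasurable f -> vmeasurable g ->
  vmeasurable (fun z => f z - g z).
Proof.
move=> mf mg; have := vmeasurable_lin (-1) mg mf.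
by under eq_fun do rewrite scaleN1r addrC.
Qed.

Hypothesis hK : separable K.

(** The squared norm is the supremum of [2 Re <x, d> - |d|^2] over a dense set
    of [d], so that its superlevel sets are countable unions of measurable
    sets. *)
Lemma measurable_ksq f : vmeasurable f -> measurable_fun setT (fun z => ksq (f z)).
Proof.
move=> mf; have [D cD dD] := hK.
apply: (measurability (@RGenOInfty.G R)).
  exact: RGenOInfty.measurableE.
move=> _ [_ [a ->] <-].
pose A d := [set z | a < 2 * complex.Re (dot (f z) d) - ksq d].
have -> : setT `&` (fun z => ksq (f z)) @^-1` `]a, +oo[%classic = \bigcup_(d in D) A d.
  apply/seteqP; split => z /=; rewrite in_itv /= andbT.
    move=> [_ az]; pose eps := Num.sqrt ((ksq (f z) - a) / 2).
    have eps0 : 0 < eps by rewrite sqrtr_gt0 divr_gt0// subr_gt0.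
    have [|d [hd Dd]] := dD (interior (ball (f z) eps%:C)) _ (@open_interior _ _).
      exists (f z); apply: nbhs_singleton; apply: nbhs_interior.
      by apply: nbhsx_ballx; rewrite ltcR.
    exists d => //; rewrite /A /=.
    have := ball_ksq eps0 (interior_subset hd).
    rewrite sqr_sqrtr; last by rewrite divr_ge0// subr_ge0 ltW.
    by rewrite ksqB; lra.
  move=> [d _]; rewrite /A /=; have := ksq_ge0 (f z - d); rewrite ksqB => ? ?.
  by split => //; lra.
have /countable_injP[c cinj] := cD.
have -> : \bigcup_(d in D) A d =
    \bigcup_n [set z | exists d, [/\ D d, c d = n & A d z]].
  apply/seteqP; split => z /=.
    by move=> [d Dd Az]; exists (c d) => //; exists d.
  by move=> [n _ [d [Dd _ Az]]]; exists d.
apply: bigcupT_measurable => n.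
have [[d [Dd cd]]|nd] := pselect (exists d, D d /\ c d = n); last first.
  rewrite (_ : mkset _ = set0)//; apply/seteqP; split => z // [d [Dd cd _]].
  by apply: nd; exists d.
rewrite (_ : mkset _ = A d); last first.
  apply/seteqP; split => z /=; last by exists d.
  move=> [d' [Dd' cd']]; rewrite (cinj d' d) ?inE// ?cd' ?cd//.
have mg : measurable_fun setT (fun z => 2 * complex.Re (dot (f z) d) - ksq d).
  by apply: measurable_funB => //; apply: measurable_funM => //; case: (mf d).
rewrite (_ : A d = setT `&` (fun z => 2 * complex.Re (dot (f z) d) - ksq d) @^-1` `]a, +oo[%classic).
  exact: mg.
by apply/seteqP; split => z /=; rewrite in_itv /= andbT; [split|case].
Qed.

(** By polarization. *)
Lemma cmeasurable_dot f g : vmeasurable f -> vmeasurable g ->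
  cmeasurable (fun z => dot (f z) (g z)).
Proof.
have half f' g' : vmeasurable f' -> vmeasurable g' ->
    measurable_fun setT (fun z => complex.Re (dot (f' z) (g' z))).
  move=> mf mg.
  rewrite (_ : (fun z => _) = fun z => 2^-1 * (ksq (f' z + g' z) - (ksq (f' z) + ksq (g' z)))).
    apply: measurable_funM => //; apply: measurable_funB.
      exact/measurable_ksq/vmeasurableD.
    by apply: measurable_funD; exact: measurable_ksq.
  by apply/funext => z; rewrite ksqD; field.
move=> mf mg; split; first exact: half.
rewrite (_ : (fun z => _) = fun z => complex.Re (dot (f z) ((0 +i* 1) *: g z))).
  by apply: half => //; apply: vmeasurableZ => //; exact: cmeasurable_cst.
apply/funext => z; rewrite dotZr conjE /=.
by case: (dot _ _) => a b /=; ring.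
Qed.

Lemma L2norm_lty f : vmeasurable f ->
  (L2norm f < +oo)%E <-> rintegrable (fun z => ksq (f z)).
Proof.
move=> mf.
have E : (\int[m]_z (`|(rnorm (f z))%:E| `^ 2) = \int[m]_z (ksq (f z))%:E)%E.
  apply: eq_integral => z _; rewrite abse_EFin ger0_norm ?rnorm_ge0//.
  by rewrite poweR_EFin -rnorm_sq powR_mulrn// rnorm_ge0.
have -> : (L2norm f < +oo)%E <-> (\int[m]_z (ksq (f z))%:E < +oo)%E.
  rewrite -E /L2norm; split => h.
    rewrite -poweR_Lnorm//; exact: poweR_lty.
  rewrite unlock; exact: poweR_lty.
have mk := measurable_ksq mf.
split => [h|/integrableP[_]].
  apply/integrableP; split; first exact/measurable_EFinP.
  by under eq_integral do rewrite /= ger0_norm ?ksq_ge0//.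
by under eq_integral do rewrite /= ger0_norm ?ksq_ge0//.
Qed.

Lemma L2normE f : rintegrable (fun z => ksq (f z)) ->
  L2norm f = (Num.sqrt (Rintegral m setT (fun z => ksq (f z))))%:E.
Proof.
move=> fi.
have E : (\int[m]_z (`|(rnorm (f z))%:E| `^ 2) = \int[m]_z (ksq (f z))%:E)%E.
  apply: eq_integral => z _; rewrite abse_EFin ger0_norm ?rnorm_ge0//.
  by rewrite poweR_EFin -rnorm_sq powR_mulrn// rnorm_ge0.
rewrite /L2norm unlock E -[X in (X `^ _)%E]fineK; last exact: integrable_fin_num.
rewrite poweR_EFin powR12_sqrt//.
by apply: Rintegral_ge0 => z _; exact: ksq_ge0.
Qed.

Lemma L2P f : L2 f <-> vmeasurable f /\ rintegrable (fun z => ksq (f z)).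
Proof.
by split => -[mf fi]; split => //; move: fi => /L2norm_lty; apply.
Qed.

Lemma L2_comb a f g : L2 f -> L2 g -> L2 (fun z => a *: f z + g z).
Proof.
move=> /L2P[mf fi] /L2P[mg gi]; apply/L2P.
have mfg := vmeasurable_lin a mf mg; split => //.
apply: (rintegrable_le _ (rintegrableD (rintegrableZ (2 * nsq a) fi) (rintegrableZ 2 gi))).
  exact: measurable_ksq.
move=> z; rewrite ger0_norm ?ksq_ge0// (le_trans (ksqD_le _ _))// ksqZ.
by rewrite mulrA.
Qed.

Lemma L2_cst (x : K) : L2 (fun=> x).
Proof. by apply/L2P; split; [exact: vmeasurable_cst | exact: rintegrable_cst]. Qed.

Lemma cintegrable_dot f g : L2 f -> L2 g -> cintegrable (fun z => dot (f z) (g z)).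
Proof.
move=> /L2P[mf fi] /L2P[mg gi].
apply: (@cintegrable_le _ _ (fun z => ksq (f z) + ksq (g z))).
- exact: cmeasurable_dot.
- exact: rintegrableD.
- by move=> z; rewrite addr_ge0 ?ksq_ge0.
move=> z; apply: le_trans (dot_cauchy_schwarz _ _) _.
by have := ksq_ge0 (f z); have := ksq_ge0 (g z); nra.
Qed.

Lemma L2dot_linearl a f g h : L2 f -> L2 g -> L2 h ->
  L2dot (fun z => a *: f z + g z) h = a * L2dot f h + L2dot g h.
Proof.
move=> f2 g2 h2; rewrite /L2dot -cintegralZ; last exact: cintegrable_dot.
rewrite -cintegralD; [|exact/cintegrableZ/cintegrable_dot|exact: cintegrable_dot].
by apply: eq_cintegral => z; rewrite dot_linearl.
Qed.

Lemma L2dotC f g : L2 f -> L2 g -> L2dot g f = Num.conj (L2dot f g).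
Proof.
move=> f2 g2; rewrite /L2dot -cintegralJ; last exact: cintegrable_dot.
by apply: eq_cintegral => z; rewrite -dotC.
Qed.

Lemma L2dotxx f : L2 f ->
  L2dot f f = (Rintegral m setT (fun z => ksq (f z)))%:C.
Proof.
move=> /L2P[_ fi]; rewrite /L2dot -cintegral_real//.
by apply: eq_cintegral => z; rewrite dotxx.
Qed.

(** Weak measurability has to be assumed for [g]: it is not stable under
    equality almost everywhere. *)
Lemma L2_ae_isometric f g : L2 f -> vmeasurable g ->
  {ae m, forall z, ksq (g z) = ksq (f z)} -> L2 g.
Proof.
move=> /L2P[mf fi] mg fg; apply/L2P; split => //.
have mgs := measurable_ksq mg; have mfs := measurable_ksq mf.
move: fi => /integrableP[_ fi]; apply/integrableP; split; first exact/measurable_EFinP.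
rewrite (_ : (\int[m]_z _ = \int[m]_z `|(ksq (f z))%:E|)%E)//.
apply: ae_eq_integral => //.
- by apply/measurable_EFinP; exact: measurableT_comp.
- by apply/measurable_EFinP; exact: measurableT_comp.
by apply: filterS fg => z /= -> _.
Qed.

Lemma ae_eq_L2dot f f' g g' : L2 f -> L2 f' -> L2 g -> L2 g' ->
  {ae m, forall z, f z = f' z} -> {ae m, forall z, g z = g' z} ->
  L2dot f g = L2dot f' g'.
Proof.
move=> /L2P[f2 _] /L2P[f2' _] /L2P[g2 _] /L2P[g2' _] ff' gg'.
apply: ae_eq_cintegral; [exact: cmeasurable_dot|exact: cmeasurable_dot|].
by apply: filterS2 ff' gg' => z -> ->.
Qed.

End SquareIntegrable.

(** * The vector space of square-integrable functions *)

Section L2Space.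
Context {R : realType} (K : hilbertType R).
Local Notation T := (circle R).
Local Notation m := (@circle_measure R).
Local Notation C := R[i].

(** Separability of [K] makes the norm of a weakly measurable function
    measurable, hence the sum of two elements of L^2 an element of L^2;
    carrying it as a parameter of the type lets the vector space structure be
    canonical. *)
Definition L2pred (hK : separable K) : {pred T -> K} := mem (@L2 R K).

Lemma L2pred_submod_closed hK : submod_closed (L2pred hK).
Proof.
split; first by rewrite inE; exact: (L2_cst hK).
by move=> a f g; rewrite !inE => hf hg; exact: (L2_comb hK).
Qed.

HB.instance Definition _ hK := GRing.isSubmodClosed.Build _ _ (L2pred hK)
  (L2pred_submod_closed hK).

Definition L2fun (hK : separable K) := {f : T -> K | f \in L2pred hK}.

HB.instance Definition _ hK := [isSub of L2fun hK for @sval _ _].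
HB.instance Definition _ hK := [Choice of L2fun hK by <:].
HB.instance Definition _ hK := [SubChoice_isSubLmodule of L2fun hK by <:].

End L2Space.

(** * Completeness of L^2 *)

Section L2Hilbert.
Context {R : realType} (K : hilbertType R) (hK : separable K).
Local Notation T := (circle R).
Local Notation m := (@circle_measure R).
Local Notation C := R[i].
Local Notation L2f := (L2fun hK).

Definition L2ip (f g : L2f) : C := L2dot (val f) (val g).

Lemma L2funP (f : L2f) : L2 (val f).
Proof. by have := valP f; rewrite inE. Qed.

Definition L2pack (f : T -> K) (hf : L2 f) : L2f := exist _ f (mem_set hf).

Lemma L2ip_linearl a (f g h : L2f) : L2ip (a *: f + g) h = a * L2ip f h + L2ip g h.
Proof. exact: (L2dot_linearl hK a (L2funP f) (L2funP g) (L2funP h)). Qed.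

Lemma L2ipC (f g : L2f) : L2ip g f = Num.conj (L2ip f g).
Proof. exact: (L2dotC hK (L2funP f) (L2funP g)). Qed.

Lemma L2ip_ge0 (f : L2f) : 0 <= L2ip f f.
Proof.
rewrite /L2ip (L2dotxx hK (L2funP f)) ler0c.
by apply: Rintegral_ge0 => z _; exact: ksq_ge0.
Qed.

Lemma L2sqE (f : L2f) : sqnorm L2ip f = Rintegral m setT (fun z => ksq (val f z)).
Proof. by rewrite /sqnorm /L2ip (L2dotxx hK (L2funP f)). Qed.

Lemma rintegrable_ksq (f : L2f) : rintegrable (fun z => ksq (val f z)).
Proof. by have /(L2P hK)[] := L2funP f. Qed.

Lemma L2sq_ae0 (f : L2f) : {ae m, forall z, val f z = 0} -> sqnorm L2ip f = 0.
Proof.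
move=> f0; rewrite L2sqE -[RHS](Rintegral_circle_cst 0).
apply: ae_eq_Rint; [exact: rintegrable_measurable (rintegrable_ksq f)|by []|].
by apply: filterS f0 => z ->; rewrite /ksq dot0l.
Qed.

Lemma L2sq_eq0 (f : L2f) : sqnorm L2ip f = 0 -> {ae m, forall z, val f z = 0}.
Proof.
rewrite L2sqE => h; have fi := rintegrable_ksq f.
have : (\int[m]_z `|(ksq (val f z))%:E| = 0)%E.
  under eq_integral do rewrite /= ger0_norm ?ksq_ge0//.
  rewrite -[LHS]fineK; last exact: integrable_fin_num.
  by congr EFin.
have mf : measurable_fun setT (fun z => (ksq (val f z))%:E).
  exact/measurable_EFinP/rintegrable_measurable.
move/(ae_eq_integral_abs _ measurableT mf); apply: filterS => z /(_ I) [].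
by move=> h0; apply: ksq_eq0; rewrite h0.
Qed.

Lemma cmeasurable_lim (w_ : nat -> T -> C) (w : T -> C) :
  (forall k, cmeasurable (w_ k)) ->
  (forall z eps, 0 < eps -> exists N, forall k, (N <= k)%N -> nsq (w_ k z - w z) <= eps ^+ 2) ->
  cmeasurable w.
Proof.
move=> mw h; split.
  apply: (@measurable_fun_cvg _ _ _ setT (fun k z => complex.Re (w_ k z))).
    by move=> k; case: (mw k).
  move=> z _; apply/cvgrPdist_le => eps eps0; have [N hN] := h z eps eps0.
  exists N => // k /= /hN hk; rewrite distrC.
  have := normRe_le (ltW eps0) hk.
  by case: (w_ k z) => ? ?; case: (w z).
apply: (@measurable_fun_cvg _ _ _ setT (fun k z => complex.Im (w_ k z))).
  by move=> k; case: (mw k).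
move=> z _; apply/cvgrPdist_le => eps eps0; have [N hN] := h z eps eps0.
exists N => // k /= /hN hk; rewrite distrC.
have := normIm_le (ltW eps0) hk.
by case: (w_ k z) => ? ?; case: (w z).
Qed.

Lemma geometric_small (c eps : R) : 0 < eps -> exists N, forall k, (N <= k)%N ->
  c * 4^-1 ^+ k <= eps.
Proof.
move=> e0.
have cv : (fun k => c * 4^-1 ^+ k) @ \oo --> (0 : R).
  rewrite -[X in _ --> X](mulr0 c); apply: cvgM; first exact: cvg_cst.
  by apply: cvg_expr; rewrite ger0_norm; lra.
have /cvgrPdist_le/(_ _ e0)[N _ hN] := cv; exists N => k /hN /=.
by rewrite sub0r normrN; apply: le_trans; exact: ler_norm.
Qed.

Lemma vmeasurable_geometric_lim (w_ : nat -> T -> K) (w : T -> K) (h : T -> R) :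
  (forall k, vmeasurable (w_ k)) ->
  (forall z k, ksq (w_ k z - w z) <= h z * 4^-1 ^+ k) -> vmeasurable w.
Proof.
move=> mw hw x; apply: (@cmeasurable_lim (fun k z => dot (w_ k z) x)).
  by move=> k; exact: mw.
move=> z eps eps0.
have e2 : 0 < eps ^+ 2 by rewrite exprn_gt0.
have [N hN] := geometric_small (h z * ksq x) e2; exists N => k /hN.
apply: le_trans; rewrite -dotBl; apply: le_trans (dot_cauchy_schwarz _ _) _.
by rewrite mulrAC ler_wpM2r ?ksq_ge0.
Qed.

Lemma geometric_series_le (k : nat) : \sum_(0 <= j < k) (4^-1 : R) ^+ j <= 2.
Proof.
have p (j : nat) : (0:R) <= 4^-1 ^+ j by rewrite exprn_ge0.
suff : \sum_(0 <= j < k) (4^-1 : R) ^+ j <= 2 - 2 * 4^-1 ^+ k by have := p k; lra.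
elim: k => [|k ih]; first by rewrite big_geq// expr0; lra.
by rewrite big_nat_recr//= exprSr; have := p k; lra.
Qed.

(** The function [h] is the sum of the series [4^k d_k], whose integral is at
    most the sum of the powers of [1/4]. *)
Lemma integrable_sup (d : nat -> T -> R) :
  (forall k, rintegrable (d k)) -> (forall k z, 0 <= d k z) ->
  (forall k, Rintegral m setT (d k) <= 16^-1 ^+ k) ->
  exists h : T -> R, [/\ rintegrable h, forall z, 0 <= h z &
    exists2 G : set T, measurable G & {ae m, forall z, G z} /\
     forall z, G z -> forall k, 4 ^+ k * d k z <= h z].
Proof.
move=> id d0 hd.
pose u k z := (4 ^+ k * d k z)%:E.
have u0 k z : (0 <= u k z)%E by rewrite lee_fin mulr_ge0 ?exprn_ge0.
have mu k : measurable_fun setT (u k).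
  apply/measurable_EFinP; apply: measurable_funM => //.
  exact: rintegrable_measurable.
pose H z := (\sum_(k <oo) u k z)%E.
have H0 z : (0 <= H z)%E by apply: nneseries_ge0 => k _ _.
have mH : measurable_fun setT H by exact: ge0_emeasurable_sum.
have iH : (\int[m]_z H z < +oo)%E.
  rewrite integral_nneseries//.
  apply: (@le_lt_trans _ _ 2%:E); last exact: ltry.
  apply: lime_le.
    by apply: is_cvg_nneseries => k _ _; exact: integral_ge0.
  apply: nearW => k.
  apply: (@le_trans _ _ (\sum_(0 <= j < k) (4^-1 ^+ j)%:E)%E); last first.
    by rewrite sumEFin lee_fin geometric_series_le.
  apply: lee_sum => j _.
  rewrite -[leLHS]fineK; last exact: integrable_fin_num (rintegrableZ _ (id j)).
  rewrite lee_fin -[fine _]/(Rintegral m setT (fun z => 4 ^+ j * d j z)) RintZ//.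
  apply: le_trans (ler_wpM2l _ (hd j)) _; first by rewrite exprn_ge0.
  by rewrite -exprMn (_ : 4 * 16^-1 = 4^-1)//; field.
have integH : m.-integrable setT H.
  apply/integrableP; split => //.
  by under eq_integral do rewrite gee0_abs//.
exists (fine \o H); split.
- apply: (le_integrable measurableT _ _ integH).
    by apply/measurable_EFinP; exact: measurableT_comp.
  by move=> z _ /=; have := H0 z; case: (H z) => [r||] //= _; rewrite leey.
- by move=> z; exact/fine_ge0.
exists [set z | H z \is a fin_num].
  by rewrite -[X in measurable X]setTI; exact: emeasurable_fin_num.
split.
  by have := integrable_ae measurableT integH; apply: filterS => z /(_ I).
move=> z Hz k; rewrite -lee_fin /= fineK//.
rewrite /H; apply: le_trans (nneseries_lim_ge k.+1 _) => //.
rewrite big_nat_recr//= leeDr// sume_ge0//.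
Qed.

(** The bounds of [integrable_sup] make the sequence converge in [K] at almost
    every point, at a rate [4^-k] times an integrable function. The
    exceptional set is measurable, and the sequence is replaced by zero there,
    so that the limit is measurable everywhere. *)
Lemma L2_complete (u : nat -> L2f) :
  (forall k, sqnorm L2ip (u k.+1 - u k) <= 16^-1 ^+ k) ->
  exists v, exists c : R, forall k, sqnorm L2ip (u k - v) <= c * 4^-1 ^+ k.
Proof.
move=> hu.
have [h [ih h0 [G mG [aG hG]]]] := @integrable_sup
  (fun k z => ksq (val (u k.+1 - u k) z)) (fun k => rintegrable_ksq _)
  (fun k z => ksq_ge0 _) (fun k => le_trans (eq_ind_r (fun x => x <= _) (lexx _) (esym (L2sqE _))) (hu k)).
(* [w] is [u], set to zero where the increments are not under control. *)
pose w k z : K := (\1_G z : R)%:C *: val (u k) z.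
have mw k : vmeasurable (w k).
  apply: vmeasurableZ; last by have /(L2P hK)[] := L2funP (u k).
  by split => /=; [exact: measurable_indic|exact: measurable_cst].
have wG k z : G z -> w k z = val (u k) z.
  by move=> Gz; rewrite /w indicE mem_set// scale1r.
have hw z k : 4 ^+ k * ksq (w k.+1 z - w k z) <= h z.
  have [Gz|nG] := pselect (G z); first by rewrite !wG//; exact: hG.
  rewrite /w indicE memNset// !scale0r subr0 /ksq dot0l mulr0//.
have /boolp.choice[v hv] z : exists v, forall k, ksq (w k z - v) <= 4 * h z * 4^-1 ^+ k.
  exact: complete_geometric (hw z).
have mv : vmeasurable v by exact: vmeasurable_geometric_lim mw hv.
have bound k z : ksq (w k z - v z) <= 4 * h z.
  apply: le_trans (hv z k) _; rewrite ler_piMr ?mulr_ge0//.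
  by rewrite exprn_ile1//; lra.
have vL2 : L2 v.
  apply/(L2P hK); split => //.
  apply: (rintegrable_le _ (rintegrableD (rintegrableZ 2 (rintegrable_ksq (u 0%N))) (rintegrableZ 8 ih))).
    exact: (measurable_ksq hK).
  move=> z; rewrite ger0_norm ?ksq_ge0// -[v z](subrK (w 0%N z)).
  apply: le_trans (ksqD_le _ _) _; rewrite ksqBC addrC; apply: lerD.
    rewrite ler_pM2l// /w ksqZ indicE; case: (_ \in _) => /=; rewrite /nsq /=.
      by rewrite expr1n expr0n addr0 mul1r.
    by rewrite expr0n addr0 mul0r ksq_ge0.
  by have := bound 0%N z; lra.
exists (L2pack vL2), (Rintegral m setT (fun z => 4 * h z)) => k.
rewrite L2sqE mulrC -RintZ; last exact: rintegrableZ.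
rewrite (@ae_eq_Rint _ _ (fun z => ksq (w k z - v z))).
- apply: le_Rintegral => //.
  + apply: (rintegrable_le _ (rintegrableZ 4 ih)).
      apply: (measurable_ksq hK); exact: vmeasurableB.
    by move=> z; rewrite ger0_norm ?ksq_ge0.
  + by do 2 apply: rintegrableZ.
  + by move=> z _; rewrite mulrC; exact: hv.
- exact: rintegrable_measurable (rintegrable_ksq _).
- by apply: (measurable_ksq hK); exact: vmeasurableB.
by apply: filterS aG => z Gz; rewrite wG.
Qed.

End L2Hilbert.

(** * The Fourier basis of L^2 *)

Section FourierBasis.
Context {R : realType} (K : hilbertType R) (hK : separable K).
Context (I : choiceType) (e : I -> K) (he : orthonormal_basis e).
Local Notation T := (circle R).
Local Notation m := (@circle_measure R).
Local Notation C := R[i].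
Implicit Types (f g : T -> K).

Definition monomial (n : int) (x : K) : T -> K := fun z => val z ^ n *: x.

Lemma L2_twist (n : int) f : L2 f -> L2 (fun z => val z ^ n *: f z).
Proof.
move=> f2; have /(L2P hK)[mf _] := f2.
apply: (L2_ae_isometric hK f2); first exact/vmeasurableZ/mf/cmeasurableX.
by apply: aeW => z; rewrite ksqZ nsqX mul1r.
Qed.

Lemma L2_monomial n x : L2 (monomial n x).
Proof. exact/L2_twist/L2_cst. Qed.

Lemma L2dot_twist (n k : int) f x :
  L2dot (fun z => val z ^ n *: f z) (monomial k x) = L2dot f (monomial (k - n) x).
Proof.
apply: eq_cintegral => z; rewrite dotZl !dotZr mulrA; congr (_ * _).
by rewrite !circle_conjX -expfzDr ?circle_neq0// opprB.
Qed.

Lemma L2dot_monomialE f n x :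
  L2dot f (monomial n x) = cintegral (fun z => val z ^ (- n) * dot (f z) x).
Proof. by apply: eq_cintegral => z; rewrite dotZr circle_conjX. Qed.

Lemma L2dot_monomials (n k : int) x y :
  L2dot (monomial n x) (monomial k y) = (n == k)%:R * dot x y.
Proof.
rewrite (_ : monomial n x = fun z => val z ^ n *: (fun=> x) z)// L2dot_twist L2dot_monomialE.
rewrite (_ : (fun z => _) = fun z : T => dot x y * val z ^ (- (k - n))); last first.
  by apply/funext => z; rewrite mulrC.
rewrite cintegralZ; last first.
  have := cintegrableX (- (k - n)) (@cintegrable_cst R 1).
  by under eq_fun do rewrite mulr1.
by rewrite cintegral_moment opprB subr_eq0 mulrC.
Qed.

Definition Fcoef f (n : int) (i : I) : C := L2dot f (monomial n (e i)).

Local Notation L2f := (L2fun hK).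
Definition fourier_basis (p : int * I) : L2f := L2pack hK (L2_monomial p.1 (e p.2)).

Lemma fourier_basis_orthonormal p q :
  L2ip (fourier_basis p) (fourier_basis q) = (p == q)%:R.
Proof.
rewrite /L2ip /= L2dot_monomials he.1 -natrM mulnb.
by case: p => a b; case: q => c d.
Qed.

Lemma ae_forall_countable (P : I -> T -> Prop) :
  (forall i, {ae m, forall z, P i z}) -> {ae m, forall z, forall i, P i z}.
Proof.
move=> hP; have /countable_injP[c cinj] := countable_basis he hK.
have : {ae m, forall z, forall n i, c i = n -> P i z}.
  apply/ae_foralln => n.
  have [[i ci]|ni] := pselect (exists i, c i = n).
    apply: filterS (hP i) => z Pz j cj.
    by rewrite (cinj j i) ?inE// ci cj.
  by apply: aeW => z i ci; case: ni; exists i.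
by apply: filterS => z h i; exact: h (c i) i erefl.
Qed.

(** Each coordinate of [f] has vanishing Fourier coefficients, and there are
    countably many coordinates. *)
Lemma Fcoef_ae0 f : L2 f -> (forall n i, Fcoef f n i = 0) -> {ae m, forall z, f z = 0}.
Proof.
move=> f2 h.
have : {ae m, forall z, forall i, dot (f z) (e i) = 0}.
  apply: ae_forall_countable => i; apply: null_moments_ae0; split.
    exact: (cintegrable_dot hK f2 (L2_cst hK (e i))).
  by move=> n; rewrite -[RHS](h (- n) i) /Fcoef L2dot_monomialE opprK.
apply: filterS => z hz; apply: (basis_ext he) => i.
by rewrite hz dot0l.
Qed.

Lemma fourier_basis_total (f : L2f) :
  (forall p, coef (@L2ip _ _ hK) fourier_basis f p = 0) -> sqnorm (@L2ip _ _ hK) f = 0.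
Proof.
move=> h; apply: L2sq_ae0; apply: Fcoef_ae0; first exact: L2funP.
by move=> n i; exact: (h (n, i)).
Qed.

Local Notation ip_linearl := (@L2ip_linearl R K hK).
Local Notation ipC := (@L2ipC R K hK).
Local Notation ip0 := (@L2ip_ge0 R K hK).
Local Notation basisON := fourier_basis_orthonormal.
Local Notation L2cpl := (@L2_complete R K hK).
Local Notation L2tot := fourier_basis_total.

Definition L2sq f : R := Rintegral m setT (fun z => ksq (f z)).

Lemma L2sq_ge0 f : 0 <= L2sq f.
Proof. by apply: Rintegral_ge0 => z _; exact: ksq_ge0. Qed.

Lemma L2_orthogonal f g : L2 f -> L2 g ->
  (forall n i, Fcoef f n i = 0 \/ Fcoef g n i = 0) -> L2dot f g = 0.
Proof.
move=> f2 g2 h.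
apply: (ip_eq0_disjoint ip_linearl ipC ip0 basisON L2cpl L2tot (x := L2pack hK f2) (y := L2pack hK g2)).
by case=> n i; exact: h.
Qed.

Lemma L2sq_le f g : L2 f -> L2 g ->
  (forall n i, Fcoef f n i = 0 \/ Fcoef f n i = Fcoef g n i) -> L2sq f <= L2sq g.
Proof.
move=> f2 g2 h.
have := sqnorm_le_restrict ip_linearl ipC ip0 basisON L2cpl L2tot (x := L2pack hK f2) (y := L2pack hK g2).
by rewrite !L2sqE; apply; case=> n i; exact: h.
Qed.

Lemma L2_restrict (A : pred int) f : L2 f -> exists g, L2 g /\
  forall n i, Fcoef g n i = if A n then Fcoef f n i else 0.
Proof.
move=> f2.
have [g hg] := restrict_coef ip_linearl ipC ip0 basisON L2cpl (fun p => A p.1) (L2pack hK f2).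
exists (val g); split; first exact: L2funP.
by move=> n i; exact: (hg (n, i)).
Qed.

Lemma L2sqB_le f g h : L2 f -> L2 g -> L2 h ->
  L2sq (fun z => g z - h z) <= 2 * L2sq (fun z => f z - g z) + 2 * L2sq (fun z => f z - h z).
Proof.
move=> f2 g2 h2.
have := sqnormD_le ip_linearl ipC ip0 (L2pack hK g2 - L2pack hK f2) (L2pack hK f2 - L2pack hK h2).
by rewrite addrA subrK (sqnormBC ip_linearl ipC (L2pack hK g2) (L2pack hK f2)) !L2sqE; apply.
Qed.

Lemma L2_sub f g : L2 f -> L2 g -> L2 (fun z => f z - g z).
Proof. by move=> f2 g2; exact: L2funP (L2pack hK f2 - L2pack hK g2). Qed.

Lemma L2_bigsum (J : Type) (s : seq J) (x : J -> T -> K) :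
  (forall j, L2 (x j)) -> L2 (fun z => \sum_(j <- s) x j z).
Proof.
move=> x2; elim: s => [|j s ih].
  by under eq_fun do rewrite big_nil; exact: L2_cst.
under eq_fun do rewrite big_cons -[x j _]scale1r.
exact: L2_comb.
Qed.

Lemma L2dot_sum (J : Type) (s : seq J) (a : J -> C) (x : J -> T -> K) g :
  (forall j, L2 (x j)) -> L2 g ->
  L2dot (fun z => \sum_(j <- s) a j *: x j z) g = \sum_(j <- s) a j * L2dot (x j) g.
Proof.
move=> x2 g2; elim: s => [|j s ih].
  rewrite big_nil; under [X in L2dot X]eq_fun do rewrite big_nil.
  rewrite /L2dot (_ : (fun z => _) = fun=> 0); last by apply/funext => z; rewrite dot0l.
  by rewrite /cintegral /= !Rintegral_circle_cst.
rewrite big_cons -ih -(L2dot_linearl hK)//; first by under eq_fun do rewrite big_cons.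
by apply: L2_bigsum => k; have := L2_comb hK (a k) (x2 k) (L2_cst hK 0); under eq_fun do rewrite addr0.
Qed.

Lemma L2dotB f g h : L2 f -> L2 g -> L2 h ->
  L2dot (fun z => f z - g z) h = L2dot f h - L2dot g h.
Proof.
move=> f2 g2 h2.
exact: (ipBl ip_linearl (L2pack hK f2) (L2pack hK g2) (L2pack hK h2)).
Qed.

Lemma L2_cauchy_schwarz f g : L2 f -> L2 g -> nsq (L2dot f g) <= L2sq f * L2sq g.
Proof.
move=> f2 g2.
by have := cauchy_schwarz ip_linearl ipC ip0 (L2pack hK f2) (L2pack hK g2); rewrite !L2sqE.
Qed.

(** Both sides are conjugate-linear and bounded in the test vector, so it
    suffices to test on the basis. *)
Lemma is_fourier_coeffP f n c : L2 f ->
  is_fourier_coeff f n c <-> forall i, dot c (e i) = Fcoef f n i.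
Proof.
move=> f2; split; first by move=> h i; rewrite /Fcoef L2dot_monomialE -h.
move=> h x; rewrite -L2dot_monomialE; apply/eqP; rewrite -subr_eq0; apply/eqP.
apply: nsq_eq0.
have fB y y' : L2dot f (monomial n (y - y')) = L2dot f (monomial n y) - L2dot f (monomial n y').
  rewrite (L2dotC hK (L2_monomial _ _) f2).
  rewrite (_ : monomial n (y - y') = fun z => monomial n y z - monomial n y' z); last first.
    by apply/funext => z; rewrite /monomial scalerBr.
  rewrite L2dotB//; try exact: L2_monomial.
  by rewrite rmorphB /= -!(L2dotC hK)//; exact: L2_monomial.
pose B := 2 * ksq c + 2 * L2sq f.
have bound y : nsq (dot c y - L2dot f (monomial n y)) <= B * ksq y.
  apply: le_trans (nsqD_le _ _) _; rewrite nsqN /B (mulrDl (2 * ksq c)) -!mulrA.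
  apply: lerD; rewrite ler_pM2l//; first exact: dot_cauchy_schwarz.
  apply: le_trans (L2_cauchy_schwarz f2 (L2_monomial _ _)) _.
  rewrite {2}/L2sq (_ : (fun z => _) = fun=> ksq y) ?Rintegral_circle_cst//.
  by apply/funext => z; rewrite /monomial ksqZ nsqX mul1r.
have B0 : 0 <= B.
  by rewrite addr_ge0// mulr_ge0// ?ksq_ge0//; apply: Rintegral_ge0 => z _; exact: ksq_ge0.
rewrite leNgt; apply/negP => t0.
have e0 : 0 < nsq (dot c x - L2dot f (monomial n x)) / (B + 1) / 2.
  by rewrite !divr_gt0//; lra.
have [F /(_ F (fsubset_refl _)) hF] := basis_expansion he x e0.
set s := \sum_(i <- F) _ in hF.
have s0 : dot c s - L2dot f (monomial n s) = 0.
  rewrite (L2dotC hK (L2_monomial _ _) f2).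
  rewrite (_ : monomial n s = fun z => \sum_(i <- F) dot x (e i) *: monomial n (e i) z); last first.
    apply/funext => z; rewrite /monomial scaler_sumr; apply: eq_bigr => i _.
    by rewrite !scalerA mulrC.
  rewrite L2dot_sum//; last by move=> i; exact: L2_monomial.
  rewrite dot_sumr rmorph_sum /=; apply/eqP; rewrite subr_eq0; apply/eqP.
  apply: eq_bigr => i _; rewrite dotZr h rmorphM /=; congr (_ * _).
  by rewrite -(L2dotC hK)//; exact: L2_monomial.
have := bound (x - s).
rewrite (_ : _ - _ = dot c x - L2dot f (monomial n x)); last first.
  by move/eqP: s0; rewrite dotBr fB subr_eq0 => /eqP ->; ring.
move=> hx.
have h2 : nsq (dot c x - L2dot f (monomial n x)) <=
    B * (nsq (dot c x - L2dot f (monomial n x)) / (B + 1) / 2).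
  by apply: le_trans hx _; rewrite ler_wpM2l.
suff : B * (nsq (dot c x - L2dot f (monomial n x)) / (B + 1) / 2) <
  nsq (dot c x - L2dot f (monomial n x)) by lra.
rewrite -!mulrA mulrCA gtr_pMr// mulrA ltr_pdivrMr// mulrC ltr_pdivrMl; lra.
Qed.

(** Bessel's inequality in L^2 for the family [z^n e_i], with [n] fixed, makes
    the scalar coefficients square-summable over [i], hence the coordinates of
    a vector of [K]. *)
Lemma fourier_coeffP f n : L2 f -> is_fourier_coeff f n (fourier_coeff f n).
Proof.
move=> f2.
have ON' i j : L2ip (fourier_basis (n, i)) (fourier_basis (n, j)) = (i == j)%:R.
  by rewrite basisON xpair_eqE eqxx.
have [|c hc _] := riesz_fischer (@dot_linearl R K) (@dotC R K) (@dot_ge0 R K)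
  (basis_orthonormal he) (@hilbert_complete R K) (c := Fcoef f n) (M := L2sq f).
  move=> F; have := bessel ip_linearl ipC ip0 ON' F (L2pack hK f2).
  by rewrite L2sqE.
apply: (@xgetPex _ 0 (is_fourier_coeff f n)); exists c.
by apply/is_fourier_coeffP => // i; exact: hc.
Qed.

Lemma hardyP f : hardy f <-> L2 f /\ forall n i, n < 0 -> Fcoef f n i = 0.
Proof.
split=> -[f2 h]; split=> //.
  by move=> n i n0; have /(is_fourier_coeffP _ _ f2) <- := h n n0; rewrite dot0l.
by move=> n n0; apply/is_fourier_coeffP => // i; rewrite h// dot0l.
Qed.

End FourierBasis.

(** * The synthesis operator of the adjoint frame *)

Section Model.
Context {R : realType} (K : hilbertType R) (hK : separable K).
Context (I : choiceType) (e : I -> K) (he : orthonormal_basis e).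
Local Notation T := (circle R).
Local Notation m := (@circle_measure R).
Local Notation C := R[i].
Implicit Types (f g : T -> K).
Local Notation fc := (Fcoef e).

(** Expand [f z] in the basis: [<A f, y>] is a pointwise limit of finite sums
    of products of measurable functions. *)
Lemma vmeasurable_mul_op (A : T -> K -> K) f :
  (forall z, bounded_operator (A z)) -> opmeasurable A -> vmeasurable f ->
  vmeasurable (mul_op A f).
Proof.
move=> bA mA mf y; have [F hF] := exhausting_fsets he hK.
have lin z := (bA z).1.
have AB z u v : A z (u - v) = A z u - A z v.
  by rewrite addrC -scaleN1r lin scaleN1r addrC.
have A0 z : A z 0 = 0 by have := AB z 0 0; rewrite !subrr.
have AZ z a u : A z (a *: u) = a *: A z u by rewrite -[a *: u]addr0 lin A0 addr0.
have AD z u v : A z (u + v) = A z u + A z v.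
  by have := lin z 1 u v; rewrite !scale1r.
have Asum z (s : seq I) (c : I -> K) : A z (\sum_(i <- s) c i) = \sum_(i <- s) A z (c i).
  by elim: s => [|i s ih]; rewrite ?big_nil ?A0// !big_cons AD ih.
apply: (@cmeasurable_lim _ (fun k z => \sum_(i <- F k) dot (f z) (e i) * dot (A z (e i)) y)).
  by move=> k; apply: cmeasurable_sum => i; apply: cmeasurableM.
move=> z eps eps0; have [M hM] := (bA z).2.
pose B := M ^+ 2 * ksq y.
have B0 : 0 <= B by rewrite mulr_ge0 ?sqr_ge0 ?ksq_ge0.
have e0 : 0 < eps ^+ 2 / (B + 1) by rewrite divr_gt0 ?exprn_gt0//; lra.
have [F0 hF0] := basis_expansion he (f z) e0; have [N hN] := hF F0.
exists N => k /hN /hF0 hk.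
rewrite -nsqN opprB.
have -> : \sum_(i <- F k) dot (f z) (e i) * dot (A z (e i)) y =
    dot (A z (\sum_(i <- F k) dot (f z) (e i) *: e i)) y.
  by rewrite Asum dot_suml; apply: eq_bigr => i _; rewrite AZ dotZl.
rewrite /mul_op -dotBl -AB.
apply: le_trans (dot_cauchy_schwarz _ _) _.
have hA : ksq (A z (f z - \sum_(i <- F k) dot (f z) (e i) *: e i)) <= M ^+ 2 * (eps ^+ 2 / (B + 1)).
  rewrite -rnorm_sq; apply: (@le_trans _ _ ((M * rnorm (f z - \sum_(i <- F k) dot (f z) (e i) *: e i)) ^+ 2)).
    by rewrite lerXn2r ?nnegrE ?rnorm_ge0// (le_trans _ (hM _)) ?rnorm_ge0.
  by rewrite exprMn rnorm_sq ler_wpM2l ?sqr_ge0.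
apply: le_trans (ler_wpM2r (ksq_ge0 _) hA) _.
rewrite mulrAC -/B mulrCA ger_pMr ?exprn_gt0// ler_pdivrMr; lra.
Qed.

(** Hence the adjoint of a unitary operator is its inverse, and the choice
    made in [adjoint] has a witness without the Riesz theorem. *)
Lemma adjoint_unitary (U : K -> K) x : unitary U -> adjoint U (U x) = x.
Proof.
case=> _ Uiso _.
pose P := [set w | forall x', dot (U x') (U x) = dot x' w].
have h : P (adjoint U (U x)).
  by apply: (@xgetPex _ 0 P); exists x => x'; exact: Uiso.
apply: (basis_ext he) => i.
by rewrite dotC [RHS]dotC -h Uiso.
Qed.

Lemma cmeasurable_comp_conj (w : T -> C) : cmeasurable w ->
  cmeasurable (fun z => w (circle_conj z)).
Proof.
by case=> wr wi; split; [have := measurableT_comp wr (@measurable_circle_conj R)|have := measurableT_comp wi (@measurable_circle_conj R)].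
Qed.

Lemma vmeasurable_comp_conj f : vmeasurable f -> vmeasurable (fun z => f (circle_conj z)).
Proof. by move=> mf x; exact: (cmeasurable_comp_conj (mf x)). Qed.

Lemma L2_comp_conj f : L2 f -> L2 (fun z => f (circle_conj z)).
Proof.
move=> /(L2P hK)[mf fi]; apply/(L2P hK); split; first exact: vmeasurable_comp_conj.
exact: (rintegrable_conj fi).
Qed.

Lemma L2sq_comp_conj f : L2 f -> L2sq (fun z => f (circle_conj z)) = L2sq f.
Proof. by move=> /(L2P hK)[mf fi]; exact: (Rintegral_conj fi). Qed.

Lemma L2dot_comp_conj f n x : L2 f ->
  L2dot (fun z => f (circle_conj z)) (monomial n x) = L2dot f (monomial (- n) x).
Proof.
move=> f2; rewrite /L2dot -[RHS]cintegral_conj; last exact: (cintegrable_dot hK f2 (L2_monomial hK _ _)).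
by apply: eq_cintegral => z; rewrite /monomial circle_conj_val circle_conjX opprK.
Qed.

(** Subtracting the coefficient of index [0] is what keeps the index [-1]
    empty after the shift. *)
Lemma bwd_shift_hardy f : hardy f -> hardy (bwd_shift f) /\
  forall n i, 0 <= n -> fc (bwd_shift f) n i = fc f (n + 1) i.
Proof.
move=> /(hardyP hK he)[f2 fneg].
pose c := fourier_coeff f 0.
have cE i : dot c (e i) = fc f 0 i.
  by have /(is_fourier_coeffP hK he _ _ f2) := fourier_coeffP hK he 0 f2.
have fE : bwd_shift f = fun z => val z ^ (-1) *: (f z - monomial 0 c z).
  by apply/funext => z; rewrite /bwd_shift /monomial expr0z scale1r exprN1.
have d2 : L2 (fun z => f z - monomial 0 c z) by apply: (L2_sub hK f2); exact: (L2_monomial hK).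
have cf n i : fc (bwd_shift f) n i = fc f (n + 1) i - (0 == n + 1)%:R * fc f 0 i.
  rewrite /Fcoef fE L2dot_twist opprK (L2dotB hK f2) ?L2dot_monomials ?cE//; exact: L2_monomial.
split.
  apply/(hardyP hK he); split; first by rewrite fE; exact: (L2_twist hK).
  move=> n i n0; rewrite cf; case: eqVneq => [<-|hn]; first by rewrite mul1r subrr.
  rewrite mul0r subr0 fneg//.
  by rewrite lt_neqAle eq_sym hn /= -ltzD1 ltrD2r.
by move=> n i n0; rewrite cf lt_eqF ?mul0r ?subr0// ltzD1.
Qed.

Lemma iter_bwd_shift_hardy f k : hardy f -> hardy (iter k (@bwd_shift R K) f) /\
  forall n i, 0 <= n -> fc (iter k (@bwd_shift R K) f) n i = fc f (n + k%:Z) i.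
Proof.
move=> hf; elim: k => [|k [ih1 ih2]].
  by split => // n i n0; rewrite addr0.
have [h1 h2] := bwd_shift_hardy ih1; split; first exact: h1.
move=> n i n0; rewrite iterS h2// ih2 ?addr_ge0//.
by rewrite -addrA -intS.
Qed.

Lemma iter_fwd_shift n (x : K) : iter n (@fwd_shift R K) (cst x) = monomial n x.
Proof.
elim: n => [|n ih]; first by apply/funext => z; rewrite /monomial expr0z scale1r.
by rewrite iterS ih; apply/funext => z; rewrite /fwd_shift /monomial scalerA exprSz.
Qed.

Lemma hardy_cst (x : K) : hardy (fun _ : T => x).
Proof.
apply/(hardyP hK he); split; first exact: L2_cst.
move=> n i n0; rewrite /Fcoef (_ : (fun=> x) = monomial 0 x).
  by rewrite L2dot_monomials eq_sym lt_eqF// mul0r.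
by apply/funext => z; rewrite /monomial expr0z scale1r.
Qed.

Local Notation L2f := (L2fun hK).

Definition hardy_basis (p : I * nat) : L2f := fourier_basis hK e (p.2 : int, p.1).

Lemma hardy_basis_orthonormal p q :
  L2ip (hardy_basis p) (hardy_basis q) = (p == q)%:R.
Proof.
rewrite (fourier_basis_orthonormal hK he) xpair_eqE eqz_nat.
by case: p => a b; case: q => c d; rewrite xpair_eqE andbC.
Qed.

(** The coefficients of negative index vanish, so the finite sets of indices
    may be taken in [I * nat]. *)
Lemma hardy_expansion f (eps : R) : hardy f -> 0 < eps ->
  exists F0 : {fset I * nat}, forall F, (F0 `<=` F)%fset ->
    L2sq (fun z => f z - \sum_(p <- F) fc f p.2 p.1 *: monomial p.2 (e p.1) z) <= eps.
Proof.
move=> /(hardyP hK he)[f2 fneg] eps0.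
have [G hG] := expansion (@L2ip_linearl R K hK) (@L2ipC R K hK) (@L2ip_ge0 R K hK)
  (fourier_basis_orthonormal hK he) (@L2_complete R K hK)
  (fourier_basis_total he) (L2pack hK f2) eps0.
pose j (p : I * nat) : int * I := (p.2 : int, p.1).
have jinj : injective j by move=> [a b] [c d] [-> ->].
(* The indices of [G] with negative first component are sent to irrelevant ones. *)
exists [fset (p.2, `|p.1|%N) | p in G]%fset => F FG.
have valE : (fun z => f z - \sum_(p <- F) fc f p.2 p.1 *: monomial p.2 (e p.1) z) =
    val (L2pack hK f2 - lincomb hardy_basis F (coef (@L2ip R K hK) hardy_basis (L2pack hK f2))).
  apply/funext => z; set c := coef _ _ _.
  rewrite -[RHS]/(f z - val (lincomb hardy_basis F c) z); congr (_ - _).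
  by rewrite /lincomb raddf_sum /= fct_sumE.
rewrite valE /L2sq -L2sqE.
rewrite (sqnorm_sub_lincomb (@L2ip_linearl R K hK) (@L2ipC R K hK) (@L2ip_ge0 R K hK) hardy_basis_orthonormal).
have := hG G (fsubset_refl _).
rewrite (sqnorm_sub_lincomb (@L2ip_linearl R K hK) (@L2ipC R K hK) (@L2ip_ge0 R K hK) (fourier_basis_orthonormal hK he)).
move=> h; apply: le_trans h; rewrite lerD2l lerN2.
set c := coef _ _ _; set c2 := coef _ _ _.
have -> : energy F c2 = energy [fset j p | p in F]%fset c.
  by rewrite /energy big_imfset//= => p q _ _; exact: jinj.
rewrite (@le_trans _ _ (energy ([fset j p | p in F] `|` G)%fset c))//.
  by apply: energy_le; exact: fsubsetUr.
rewrite le_eqVlt; apply/orP; left; apply/eqP/esym.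
rewrite /energy; apply: big_fset_incl; first exact: fsubsetUl.
move=> [n i]; rewrite inE => /orP[->//|nG] nF.
rewrite (_ : c (n, i) = fc f n i)// fneg ?nsq0//.
rewrite ltNge; apply/negP => n0; move/negP: nF; apply.
apply/imfsetP; exists (i, `|n|%N) => /=; last by rewrite /j /= gez0_abs.
by apply: (fsubsetP FG); apply/imfsetP; exists (n, i).
Qed.


Context (Q : T -> K -> K) (hQ : inner Q).

Lemma inner_bounded z : bounded_operator (Q z).
Proof. by case: hQ => -[]. Qed.

Lemma innerB z x y : Q z (x - y) = Q z x - Q z y.
Proof. by rewrite addrC -scaleN1r (inner_bounded z).1 scaleN1r addrC. Qed.

Lemma inner0 z : Q z 0 = 0.
Proof. by have := innerB z 0 0; rewrite !subrr. Qed.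

Lemma innerZ z a x : Q z (a *: x) = a *: Q z x.
Proof. by have := (inner_bounded z).1 a x 0; rewrite inner0 !addr0. Qed.

Lemma inner_sum z (J : Type) (s : seq J) (c : J -> K) :
  Q z (\sum_(j <- s) c j) = \sum_(j <- s) Q z (c j).
Proof.
elim: s => [|j s ih]; first by rewrite !big_nil inner0.
rewrite !big_cons -ih; have := (inner_bounded z).1 1 (c j) (\sum_(j <- s) c j).
by rewrite !scale1r.
Qed.

Lemma inner_unitary : {ae m, forall z, unitary (Q z)}.
Proof. by case: hQ. Qed.

Lemma vmeasurable_inner f : vmeasurable f -> vmeasurable (mul_op Q f).
Proof. by case: hQ => -[bQ mQ _ _] _; exact: vmeasurable_mul_op. Qed.

Lemma hardy_inner f : hardy f -> hardy (mul_op Q f).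
Proof. by case: hQ => -[_ _ _ h] _; exact: h. Qed.

Lemma ksq_inner : {ae m, forall z, forall x, ksq (Q z x) = ksq x}.
Proof. by apply: filterS inner_unitary => z [_ h _] x; rewrite /ksq h. Qed.

Lemma L2_inner f : L2 f -> L2 (mul_op Q f).
Proof.
move=> f2; have /(L2P hK)[mf _] := f2.
apply: (L2_ae_isometric hK f2); first exact: vmeasurable_inner.
by apply: filterS ksq_inner => z h; exact: h.
Qed.

Lemma L2dot_inner f g : L2 f -> L2 g -> L2dot (mul_op Q f) (mul_op Q g) = L2dot f g.
Proof.
move=> f2 g2.
have /(L2P hK)[mf _] := f2; have /(L2P hK)[mg _] := g2.
have /(L2P hK)[mf' _] := L2_inner f2; have /(L2P hK)[mg' _] := L2_inner g2.
apply: ae_eq_cintegral; [exact: (cmeasurable_dot hK)|exact: (cmeasurable_dot hK)|].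
by apply: filterS inner_unitary => z [_ h _]; exact: h.
Qed.

(** The isometry [U] such that the synthesis operator is the projection onto
    the Hardy space after [U]. *)
Definition flip f : T -> K := fun z => val z ^ (-1) *: Q z (f (circle_conj z)).

Lemma L2_flip f : L2 f -> L2 (flip f).
Proof. by move=> f2; apply/(L2_twist hK)/L2_inner/L2_comp_conj. Qed.

Lemma L2sq_flip f : L2 f -> L2sq (flip f) = L2sq f.
Proof.
move=> f2; rewrite -(L2sq_comp_conj f2); apply: ae_eq_Rint.
- by apply: (measurable_ksq hK); have /(L2P hK)[] := L2_flip f2.
- by apply: (measurable_ksq hK); have /(L2P hK)[] := L2_comp_conj f2.
by apply: filterS ksq_inner => z h; rewrite /flip ksqZ nsqX mul1r h.
Qed.

(** [U (z^n x) = z^(-n-1) Q x]. *)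
Lemma fc_flip_monomial n x k i :
  fc (flip (monomial n x)) k i = fc (mul_op Q (cst x)) (k + 1 + n) i.
Proof.
have -> : flip (monomial n x) = fun z => val z ^ (- n - 1) *: mul_op Q (cst x) z.
  apply/funext => z; rewrite /flip /monomial circle_conj_val circle_conjX innerZ scalerA.
  by rewrite -expfzDr ?circle_neq0// addrC.
by rewrite /Fcoef L2dot_twist opprD !opprK addrA addrAC.
Qed.

(** On Hardy functions the backward shift is multiplication by [z^-1] followed
    by the projection onto the Hardy space, so the frame vector of index [(i,
    n)] is the projection of [U (z^n e_i)]. *)
Lemma adjoint_frame_hardy p : hardy (adjoint_frame e Q p) /\
  forall n i, 0 <= n -> fc (adjoint_frame e Q p) n i =
    fc (flip (monomial p.2 (e p.1))) n i.
Proof.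
have [h1 h2] := bwd_shift_hardy (hardy_inner (hardy_cst (e p.1))).
have [h3 h4] := iter_bwd_shift_hardy p.2 h1; split; first exact: h3.
move=> n i n0; rewrite h4// h2 ?addr_ge0// fc_flip_monomial.
by rewrite addrAC.
Qed.

(** The sum [g] is the projection of [U f]. The partial sum over [F] is the
    projection of [U f_F], where [f_F] is the partial Fourier sum of [f],
    hence its distance to [g] is at most the distance of [f_F] to [f]. For [h]
    in the Hardy space, [<g, Q h> = <U f, Q h>] is the inner product of [z^-1
    f(conj z)], which has only negative indices, with [h]; this places [g] in
    the model space. *)
Lemma synthesis_projection f : hardy f -> exists g, [/\ model_space Q g,
  L2_sum (fun p z => L2dot f (iter p.2 (@fwd_shift R K) (cst (e p.1))) *:
    adjoint_frame e Q p z) g &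
  forall n i, 0 <= n -> fc g n i = fc (flip f) n i].
Proof.
move=> hf; have /(hardyP hK he)[f2 fneg] := hf.
have u2 := L2_flip f2.
have [g [g2 gE]] := L2_restrict hK he (fun n => 0 <= n) u2.
exists g; split; last by move=> n i n0; rewrite gE n0.
  split.
    apply/(hardyP hK he); split => // n i n0.
    by rewrite gE leNgt n0.
  move=> h hh; have /(hardyP hK he)[h2 hneg] := hh.
  have /(hardyP hK he)[Qh2 Qhneg] := hardy_inner hh.
  have : L2dot (fun z => g z - flip f z) (mul_op Q h) = 0.
    apply: (L2_orthogonal hK he) => //; first exact: (L2_sub hK).
    move=> n i; case: (leP 0 n) => n0; last by right; exact: Qhneg.
    left; rewrite /Fcoef (L2dotB hK)//; last exact: (L2_monomial hK).
    by rewrite -/(fc g n i) gE n0 subrr.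
  rewrite (L2dotB hK)// => /eqP; rewrite subr_eq0 => /eqP ->.
  pose v z := val z ^ (-1) *: f (circle_conj z).
  have v2 : L2 v by apply/(L2_twist hK)/L2_comp_conj.
  have -> : flip f = mul_op Q v.
    by apply/funext => z; rewrite /mul_op /v innerZ.
  rewrite L2dot_inner//; apply: (L2_orthogonal hK he) => // n i.
  case: (leP 0 n) => n0; last by right; exact: hneg.
  left; rewrite /Fcoef L2dot_twist (L2dot_comp_conj _ _ f2).
  by rewrite -/(fc f _ i) fneg// opprK oppr_lt0 ltzD1.
pose s (F : {fset I * nat}) z := \sum_(p <- F) fc f p.2 p.1 *: adjoint_frame e Q p z.
have af2 p : L2 (adjoint_frame e Q p) by have [/(hardyP hK he)[]] := adjoint_frame_hardy p.
have L2scale (a : C) (h : T -> K) : L2 h -> L2 (fun z => a *: h z).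
  move=> h2; have := L2_comb hK a h2 (L2_cst hK 0).
  by under eq_fun do rewrite addr0.
have s2 F : L2 (s F) by apply: (L2_bigsum hK) => p; exact: L2scale.
have small (eps : R) : 0 < eps -> exists F0 : {fset I * nat}, forall F, (F0 `<=` F)%fset ->
    L2sq (fun z => s F z - g z) <= eps.
  move=> eps0; have [F0 hF0] := hardy_expansion hf eps0; exists F0 => F /hF0.
  set r := (fun z => f z - _).
  have p2 : L2 (fun z => \sum_(p <- F) fc f p.2 p.1 *: monomial p.2 (e p.1) z).
    by apply: (L2_bigsum hK) => p; apply/L2scale/(L2_monomial hK).
  have r2 : L2 r by exact: (L2_sub hK).
  apply: le_trans; rewrite -(L2sq_flip r2).
  have -> : L2sq (fun z => s F z - g z) = L2sq (fun z => g z - s F z).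
    by congr Rintegral; apply/funext => z; rewrite ksqBC.
  apply: (L2sq_le hK he); [exact: (L2_sub hK)|exact: L2_flip|move=> n i].
  rewrite /Fcoef (L2dotB hK)//; last exact: (L2_monomial hK).
  rewrite -/(fc g n i) gE (L2dot_sum hK)//; last exact: (L2_monomial hK).
  have flipr : flip r = fun z => flip f z - \sum_(p <- F) fc f p.2 p.1 *: flip (monomial p.2 (e p.1)) z.
    apply/funext => z; rewrite /flip innerB scalerBr inner_sum scaler_sumr; congr (_ - _).
    by apply: eq_bigr => p _; rewrite innerZ !scalerA mulrC.
  have fm2 p : L2 (flip (monomial p.2%:Z (e p.1))) by apply/L2_flip/(L2_monomial hK).
  rewrite flipr (L2dotB hK)//; [|by apply: (L2_bigsum hK) => p; exact: L2scale|exact: (L2_monomial hK)].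
  rewrite (L2dot_sum hK)//; last exact: (L2_monomial hK).
  case: ifPn => n0; [right|left].
    congr (_ - _); apply: eq_bigr => p _; congr (_ * _).
    by have [_ h] := adjoint_frame_hardy p; exact: h.
  rewrite sub0r big1 ?oppr0// => p _.
  have [/(hardyP hK he)[_ h] _] := adjoint_frame_hardy p.
  by rewrite [X in _ * X]h ?mulr0// ltNge.
rewrite /L2_sum.
have -> : (fun F : {fset I * nat} => L2norm (fun z => \sum_(j <- F)
    L2dot f (iter j.2 (@fwd_shift R K) (cst (e j.1))) *: adjoint_frame e Q j z - g z)) =
    (fun F => (Num.sqrt (L2sq (fun z => s F z - g z)))%:E).
  apply/funext => F; rewrite -L2normE; last by have /(L2P hK)[] := L2_sub hK (s2 F) g2.
  congr L2norm; apply/funext => z; congr (_ - _).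
  by apply: eq_bigr => p _; rewrite iter_fwd_shift.
have FF : ProperFilter (@totally (I * nat)%type) by exact: totally_filter.
apply: cvg_EFin; first by apply: nearW.
apply/cvgrPdist_le => eps eps0.
have [F0 hF0] := small (eps ^+ 2) (exprn_gt0 2 eps0).
exists F0 => // F /= /hF0 h; rewrite sub0r normrN ger0_norm ?sqrtr_ge0//.
rewrite -(@ler_pXn2r _ 2)// ?nnegrE ?sqrtr_ge0//; first by rewrite sqr_sqrtr ?L2sq_ge0.
exact: ltW.
Qed.

Lemma L2_sum_unique (J : choiceType) (x : J -> T -> K) f g :
  (forall j, L2 (x j)) -> L2 f -> L2 g -> L2_sum x f -> L2_sum x g ->
  {ae m, forall z, f z = g z}.
Proof.
move=> x2 f2 g2 hf hg.
pose s (F : {fset J}) z := \sum_(j <- F) x j z.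
have s2 F : L2 (s F) by exact: (L2_bigsum hK).
have near_sum h (eps : R) : L2 h -> L2_sum x h -> 0 < eps ->
    exists F0 : {fset J}, forall F, (F0 `<=` F)%fset -> L2sq (fun z => s F z - h z) <= eps.
  move=> h2 hh eps0.
  have : nbhs (0%:E : \bar R) [set y | (y < (Num.sqrt eps)%:E)%E].
    apply: open_nbhs_nbhs; split; first exact: open_ereal_lt_ereal.
    by rewrite /= lte_fin sqrtr_gt0.
  move=> /hh [F0 _ hF0]; exists F0 => F FF0; have := hF0 F FF0.
  rewrite /= -/(s F) L2normE; last by have /(L2P hK)[] := L2_sub hK (s2 F) h2.
  by rewrite lte_fin ltr_sqrt// => /ltW.
have d0 : L2sq (fun z => f z - g z) <= 0.
  rewrite leNgt; apply/negP => d0.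
  (* Two errors of one eighth, each doubled by [L2sqB_le], stay below the whole. *)
  have d8 : 0 < L2sq (fun z => f z - g z) / 8 by rewrite divr_gt0.
  have [F1 h1] := near_sum f _ f2 hf d8; have [F2 h2] := near_sum g _ g2 hg d8.
  have := L2sqB_le hK (s2 (F1 `|` F2)%fset) f2 g2.
  by have := h1 _ (fsubsetUl F1 F2); have := h2 _ (fsubsetUr F1 F2); lra.
have fg2 := L2_sub hK f2 g2.
have : sqnorm (@L2ip R K hK) (L2pack hK fg2) = 0.
  apply/eqP; rewrite eq_le (sqnorm_ge0 (@L2ip_ge0 R K hK)) andbT L2sqE.
  exact: d0.
move/L2sq_eq0; apply: filterS => z /= h.
by apply/eqP; rewrite -subr_eq0 h.
Qed.

Lemma Fcoef_ae0_eq0 f n i : L2 f -> {ae m, forall z, f z = 0} -> fc f n i = 0.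
Proof.
move=> f2 f0.
exact: (ip_null (@L2ip_linearl R K hK) (@L2ipC R K hK) (@L2ip_ge0 R K hK)
  (L2pack hK (L2_monomial hK n (e i))) (L2sq_ae0 (f := L2pack hK f2) f0)).
Qed.

Lemma ae_eq_Fcoef f g n i : L2 f -> L2 g -> {ae m, forall z, f z = g z} ->
  fc f n i = fc g n i.
Proof.
by move=> f2 g2 fg; apply: (ae_eq_L2dot hK) => //; [exact: (L2_monomial hK)..|exact: aeW].
Qed.

End Model.

Theorem theorem7p5 (R : realType) (K : hilbertType R) (hK : separable K)
  (I : choiceType) (e : I -> K) (he : orthonormal_basis e)
  (Q : circle R -> K -> K) (hQ : inner Q) :
  synthesis_kernel e Q = mul_op_hardy (rho Q).
Proof.
pose m := @circle_measure R.
have spec f : hardy f -> exists g, [/\ L2 g, {ae m, forall z, synthesis e Q f z = g z} &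
    forall n i, Fcoef e g n i = if 0 <= n then Fcoef e (flip Q f) n i else 0].
  move=> hf; have [g [mg sg cg]] := synthesis_projection hK he hQ hf.
  have [f2 _] := hf; have [/(hardyP hK he)[g2 gneg] _] := mg.
  exists g; split => //; last first.
    by move=> n i; case: (leP 0 n) => n0; [exact: cg | exact: gneg].
  set P := [set g | model_space Q g /\ L2_sum (fun p z =>
    L2dot f (iter p.2 (@fwd_shift R K) (cst (e p.1))) *: adjoint_frame e Q p z) g].
  have [[/(hardyP hK he)[s2 _] _] ss] : P (synthesis e Q f).
    by apply: (@xgetPex _ (cst 0) P); exists g; split.
  apply: (L2_sum_unique hK _ s2 g2 ss sg) => p.
  have [/(hardyP hK he)[h _] _] := adjoint_frame_hardy hK he hQ p.
  have := L2_comb hK (L2dot f (iter p.2 (@fwd_shift R K) (cst (e p.1)))) h (L2_cst hK 0).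
  by under eq_fun do rewrite addr0.
have uQ := inner_unitary hQ; have uQ' := ae_circle_conj uQ.
(* By unitarity, [unrho f] is the only possible preimage of [f] under [rho Q]. *)
pose unrho f z := Q (circle_conj z) (f z).
have unrhoE (f : circle R -> K) : unrho f = fun z => val z ^ (-1) *: flip Q f (circle_conj z).
  apply/funext => z; rewrite /unrho /flip circle_conj_val circle_conjX opprK circle_conjK.
  by rewrite scalerA -expfzDr ?circle_neq0// addNr expr0z scale1r.
have unrho2 f : L2 f -> L2 (unrho f).
  move=> f2; rewrite unrhoE; apply: (L2_twist hK); apply: (L2_comp_conj hK).
  exact: (L2_flip hK he hQ).
have unrho_coef f n i : L2 f -> Fcoef e (unrho f) n i = Fcoef e (flip Q f) (- n - 1) i.
  move=> f2; rewrite /Fcoef unrhoE L2dot_twist (L2dot_comp_conj hK); last exact: (L2_flip hK he hQ).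
  by rewrite opprD opprK.
apply/seteqP; split=> f.
  move=> [hf sf0]; have [f2 _] := hf; split => //.
  have [g [g2 sg cg]] := spec f hf.
  exists (unrho f).
    apply/(hardyP hK he); split; first exact: unrho2.
    move=> n i n0; rewrite unrho_coef//.
    have n1 : 0 <= - n - 1 by rewrite subr_ge0 -gtz0_ge1 oppr_gt0.
    have := cg (- n - 1) i; rewrite n1 => <-.
    apply: (Fcoef_ae0_eq0 hK) => //.
    by apply: filterS2 sg sf0 => z <- h; exact: h.
  apply: filterS uQ' => z uz _; rewrite /mul_op /rho /unrho.
  by rewrite (adjoint_unitary he).
move=> [f2 [h hh fh]].
have /(hardyP hK he)[h2 hneg] := hh.
have hE : {ae m, forall z, unrho f z = h z}.
  apply: filterS2 uQ' fh => z uz /(_ Logic.I); rewrite /mul_op /rho /unrho => ->.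
  have [_ _ /(_ (h z))[x <-]] := uz.
  by rewrite (adjoint_unitary he).
(* For [n < 0], [h (conj z)] has indices [<= 0] and [z^(-n) Q e_i] indices [>= -n]. *)
have hf : hardy f.
  apply/(hardyP hK he); split => // n i n0.
  have -> : Fcoef e f n i = L2dot (fun z => h (circle_conj z))
      (fun z => val z ^ (- n) *: mul_op Q (cst (e i)) z).
    have hc2 := L2_comp_conj hK h2.
    have Qe2 := L2_inner hK he hQ (L2_cst hK (e i)).
    have w2 := L2_twist hK (- n) Qe2.
    rewrite /Fcoef -[n in LHS]opprK -(L2dot_comp_conj hK)//.
    have fc2 := L2_comp_conj hK f2.
    rewrite -(L2dot_inner hK he hQ fc2 (L2_monomial hK (- n) (e i))).
    apply: (ae_eq_L2dot hK) => //.
    - exact: (L2_inner hK he hQ).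
    - exact/(L2_inner hK he hQ)/(L2_monomial hK).
    - have := ae_circle_conj hE; apply: filterS => z <-.
      by rewrite /mul_op /unrho circle_conjK.
    by apply: aeW => z; rewrite /mul_op /monomial (innerZ hQ).
  apply: (L2_orthogonal hK he); [exact: (L2_comp_conj hK)|exact/(L2_twist hK)/(L2_inner hK he hQ)/L2_cst|].
  move=> k j; rewrite /Fcoef L2dot_twist (L2dot_comp_conj hK)//.
  case: (ltP 0 k) => k0.
    by left; apply: hneg; rewrite oppr_lt0.
  right; have /(hardyP hK he)[_ Qneg] := hardy_inner hQ (hardy_cst hK he (e i)).
  by apply: Qneg; rewrite opprK; lra.
split => //.
have [g [g2 sg cg]] := spec f hf.
have g0 : {ae m, forall z, g z = 0}.
  apply: (Fcoef_ae0 hK he g2) => n i; rewrite cg; case: ifPn => // n0.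
  (* This rewrites the coefficient of index [n >= 0] of [flip Q f] as the one of [h] of index [-n-1]. *)
  have -> : n = - (- n - 1) - 1 by rewrite opprD !opprK addrK.
  rewrite -unrho_coef// (ae_eq_Fcoef hK _ _ _ (unrho2 _ f2) h2 hE).
  by apply: hneg; rewrite -opprD oppr_lt0 ltzD1.
by apply: filterS2 sg g0 => z -> -> _.
Qed.
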